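(* Assume that the non-stationary shift with potentials $((\Sigma_n),T,(\varphi_n))$ satisfies property $(\mathrm{H}^\ast)$ and that $r\in(0,1)$ is the Hölder parameter of the $\varphi_k$. Let $\beta\in(0,1)$, and let $\alpha_k,\overline{d}_k,W_k,\overline{D}_k,n_k,m_k,t_k$ be as in the context. Assume that for each $k\in\mathbb{N}_0$, $f_k:\Sigma_k\to\mathbb{R}$ is $r$-Hölder continuous and $\mu_k,\nu_k$ are Borel probability measures on $\Sigma_k$. With $l_k:=n_k+m_{k+n_k}$, for every $k\in\mathbb{N}_0$: (i) $\overline{D}_{k+n_k}(\mathcal{L}_k^{n_k}(f_k))\le\overline{D}_k(f_k)$; (ii) $\overline{D}_{k+l_k}(\mathcal{L}_k^{l_k}(f_k))\le t_k\,\overline{D}_k(f_k)$; (iii) $W_k\big((\mathcal{L}_k^{n_k})^\ast(\mu_{k+n_k}),(\mathcal{L}_k^{n_k})^\ast(\nu_{k+n_k})\big)\le W_{k+n_k}(\mu_{k+n_k},\nu_{k+n_k})$; (iv) $W_k\big((\mathcal{L}_k^{l_k})^\ast(\mu_{k+l_k}),(\mathcal{L}_k^{l_k})^\ast(\nu_{k+l_k})\big)\le t_k\,W_{k+l_k}(\mu_{k+l_k},\nu_{k+l_k})$.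
   Context: **Non-stationary shift.** $\mathbb{N}_0=\mathbb{N}\cup\{0\}$. For each $n\in\mathbb{N}_0$ let $\mathcal{W}^1_n\subset\mathbb{N}$ and $A_n=(\alpha^n_{ij}:i\in\mathcal{W}^1_n,j\in\mathcal{W}^1_{n+1})$ a matrix with entries in $\{0,1\}$ such that $\sum_{j}\alpha^n_{ij}>0$ for all $i\in\mathcal{W}^1_n$, $n\in\mathbb{N}_0$, and $\sum_{j\in\mathcal{W}^1_{n-1}}\alpha^{n-1}_{ji}>0$ for all $i\in\mathcal{W}^1_n$, $n\in\mathbb{N}$. Put $\Sigma_n=\{(x_0,x_1,\dots):\alpha^{n+i}_{x_ix_{i+1}}=1\ \forall i\ge0\}$ and let $T:\Sigma_n\to\Sigma_{n+1}$ be the shift. $\mathcal{W}^k_n$ is the set of $n$-admissible words $(x_0,\dots,x_{k-1})$: $x_i\in\mathcal{W}^1_{n+i}$ and $\alpha^{n+i}_{x_ix_{i+1}}=1$ for consecutive letters. $[a]_n=\{x\in\Sigma_n:x_i=a_i,\ 0\le i<k\}$ for $a\in\mathcal{W}^k_n$; $\tau_a:T^k([a]_n)\to[a]_n$, $x\mapsto ax$, is the inverse branch. $d_r(x,y)=r^{\min\{i:x_i\ne y_i\}}$. **Topological conditions.** $((\Sigma_n),T)$ is topologically transitive if for all $a\in\mathcal{W}^1_{k_1}$, $b\in\mathcal{W}^1_{k_2}$ ($k_1,k_2\in\mathbb{N}_0$) there is a sequence $n_l\nearrow\infty$ with $b\in\mathcal{W}^1_{k_1+n_l}$ and $[a]_{k_1}\cap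 T^{-n_l}([b]_{k_1+n_l})\ne\emptyset$ for all $l$. It is topologically mixing if it is topologically transitive and for all such $a,b$ there is $N_{ab}$ with $[a]_{k_1}\cap T^{-n}([b]_{k_1+n})\ne\emptyset$ for all $n\ge N_{ab}$ with $b\in\mathcal{W}^1_{k_1+n}$. It has big preimages (b.p.) if it is topologically mixing and there are a finite $\mathcal{I}\subset\mathbb{N}$ and an infinite $\mathcal{K}\subset\mathbb{N}$ such that for all $n\in\mathcal{K}$ and $a\in\mathcal{W}^1_n$ there is $b\in\mathcal{I}\cap\mathcal{W}^1_{n-1}$ with $ba\in\mathcal{W}^2_{n-1}$. **Hölder continuity.** For $f:\Sigma_n\to\mathbb{R}$, $V_k(f)=\sup\{|f(x)-f(y)|:x,y\in[a]_n,\ a\in\mathcal{W}^k_n\}$. $f$ is locally $(r,m)$-Hölder continuous if there is $\kappa\ge0$ with $V_k(f)\le\kappa r^k$ for all $k\ge m$; the minimal such $\kappa$ is the Hölder constant of index $m$. $f$ is $r$-Hölder continuous if it is locally $(r,m)$-Hölder for some $m$ and $\|f\|_\infty<\infty$. **Ruelle operators.** For $\varphi_k:\Sigma_k\to\mathbb{R}$, $\mathcal{L}_k(f)(x)=\sum_{Ty=x}e^{\varphi_k(y)}f(y)$ ($x\in\Sigma_{k+1}$), $\mathcal{L}^n_k=\mathcal{L}_{k+n-1}\circ\cdots\circ\mathcal{L}_k$, $S_n\varphi_k=\sum_{i=0}^{n-1}\varphi_{k+i}\circ T^i$, and $\int f\,d(\mathcal{L}^n_k)^\ast(\mu)=\int\mathcal{L}^n_k(f)\,d\mu$,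 mapping Borel probabilities on $\Sigma_{k+n}$ to Borel probabilities on $\Sigma_k$ when $\mathcal{L}_j(1)=1$ for all $j$. **Property $(\mathrm{H}^\ast)$:** $((\Sigma_n),T)$ has big preimages, $\mathcal{L}_n(1)=1$ for all $n\in\mathbb{N}_0$, and $\varphi_n$ is locally $(r,2)$-Hölder continuous for $n\in\mathbb{N}_0\setminus\mathcal{K}$ and locally $(r,1)$-Hölder continuous for $n\in\mathcal{K}$. $\kappa_n$ is the Hölder constant (of index $2$) of $\varphi_n$ and $B_k:=\exp\sum_{i=1}^{k}\kappa_{k-i}r^i$. **Constants.** $\alpha_k=B_k/\beta$; $\overline{d}_k(x,y)=\min\{1,\alpha_kd_r(x,y)\}$ on $\Sigma_k$; $\overline{D}_k(f)=\sup_{x\ne y}|f(x)-f(y)|/\overline{d}_k(x,y)$; $W_k(\mu,\nu)=\inf\{\int\overline{d}_k\,dm\}$ over all couplings $m$ of $\mu,\nu$ (Borel probabilities on $\Sigma_k^2$ with marginals $\mu,\nu$). $n_k\in\mathbb{N}$ is any choice with $n_k\ge\lfloor-\log\alpha_k/\log r\rfloor+1$. Choose $\mathbf{o}_k\in\mathcal{W}^1_k$ and let $m_k$ be the least $n\ge1$ with $k+n\in\mathcal{K}$ and $(A_kA_{k+1}\cdots A_{k+n-2})_{\mathbf{o}_kj}\ge1$ for all $j\in\mathcal{I}\cap\mathcal{W}^1_{k+n-1}$ (finite by mixing; the empty product is the identity). Fix a finite set $\mathcal{U}_k\subset\mathcal{W}^{m_k}_k$ containing, for each $j\in\mathcal{I}\cap\mathcal{W}^1_{k+m_k-1}$,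 a word starting with $\mathbf{o}_k$ and ending with $j$, and for each $x\in\Sigma_{k+m_k}$ choose $u(x)\in\mathcal{U}_k$, starting with $\mathbf{o}_k$ and ending in an element of $\mathcal{I}$, with $x\in T^{m_k}([u(x)]_k)$. Set $C_k=\inf_{x\in\Sigma_{k+m_k}}e^{S_{m_k}\varphi_k(\tau_{u(x)}x)}$ and $$t_k=\max\Big\{\beta,\ 1-\frac{(1-r^{n_k}\alpha_k)\,C_{k+n_k}}{B_{k+n_k}}\Big\}.$$ *)

(* Defs.v *)
From HB Require Import structures.
From mathcomp Require Import all_boot all_order all_algebra.
From mathcomp Require Import all_classical all_reals all_analysis.

Set Implicit Arguments.
Unset Strict Implicit.
Unset Printing Implicit Defensive.

Import Order.TTheory GRing.Theory Num.Theory.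
Import numFieldNormedType.Exports.

Local Open Scope classical_set_scope.
Local Open Scope ring_scope.

(* A sum of 0/1 entries is positive iff one of the entries is 1; this is how
   the conditions on the rows and columns of the matrices are written.
   The alphabets are nonempty: a letter of each alphabet is chosen in the
   definition of the constants anyway, and the type of points has to be
   inhabited in order to carry a sigma-algebra. *)
Record nsshift := NSShift {
  W1 : nat -> set nat ;
  alph : nat -> nat -> nat -> bool ;
  W1_neq0 : forall n, W1 n !=set0 ;
  alph_row : forall n i, W1 n i -> exists2 j, W1 n.+1 j & alph n i j ;
  alph_col : forall n i, W1 n.+1 i -> exists2 j, W1 n j & alph n j i }.

Definition admissible (S : nsshift) (n : nat) : set {ptws nat -> nat} :=
  [set x | forall i, W1 S (i + n) (x i) /\ alph S (i + n) (x i) (x i.+1)].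

(* Sigma_n, with the topology induced by the product of discrete topologies
   (the topology of every d_r) and its Borel sigma-algebra. *)
Definition Sig (S : nsshift) (n : nat) : Type := set_type (@admissible S n).

Definition point_fun S n : nat -> nat :=
  fix x i := if i is j.+1
    then xget 0%N [set b | W1 S (j + n).+1 b /\ alph S (j + n) (x j) b]
    else xget 0%N (W1 S n).

Lemma point_fun_admissible S n : point_fun S n \in @admissible S n.
Proof.
have W i : W1 S (i + n) (point_fun S n i).
  elim: i => [|i IHi] /=; first by case: (W1_neq0 S n) => w; apply: xgetI.
  case: (alph_row IHi) => j jW ja.
  by have [] := @xgetPex _ 0%N [set b | W1 S (i + n).+1 b
    /\ alph S (i + n) (point_fun S n i) b] (ex_intro _ j (conj jW ja)).
apply/mem_set => i; split; first exact: W.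
case: (alph_row (W i)) => j jW ja.
by have [] := @xgetPex _ 0%N [set b | W1 S (i + n).+1 b
    /\ alph S (i + n) (point_fun S n i) b] (ex_intro _ j (conj jW ja)).
Qed.

HB.instance Definition _ S n := Topological.on (Sig S n).
HB.instance Definition _ S n := isPointed.Build (Sig S n)
  (exist _ (point_fun S n) (point_fun_admissible S n)).
HB.instance Definition _ S n :=
  Measurable.copy (Sig S n) (g_sigma_algebraType (@open (Sig S n))).

Definition letter S n (x : Sig S n) : nat -> nat := set_val x.
Coercion letter : Sig >-> Funclass.

Lemma T_admissible S n (x : Sig S n) :
  (fun i => x i.+1) \in @admissible S n.+1.
Proof.
by apply/mem_set => i; rewrite addnS -addSn; exact: (set_mem (valP x)).
Qed.

Definition Tmap S n (x : Sig S n) : Sig S n.+1 :=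
  exist _ (fun i => x i.+1) (T_admissible x).

Fixpoint Titer S k n (x : Sig S k) : Sig S (n + k) :=
  if n is n'.+1 then Tmap (Titer n' x) else x.

Definition words S (n k : nat) : set (seq nat) :=
  [set a | [/\ size a = k,
    forall i, (i < k)%N -> W1 S (i + n) (nth 0%N a i) &
    forall i, (i.+1 < k)%N ->
      alph S (i + n) (nth 0%N a i) (nth 0%N a i.+1)]].

Definition cyl S n (a : seq nat) : set (Sig S n) :=
  [set x | forall i, (i < size a)%N -> x i = nth 0%N a i].

(* For a in words S k n, [T^n : [a]_k -> T^n [a]_k] is injective; tau is its
   inverse. *)
Definition tau S k n (a : seq nat) (x : Sig S (n + k))
    (h : (@Titer S k n @` cyl a) x) : Sig S k :=
  s2val (cid2 h).

Definition transitive_shift S := forall (k1 k2 a b : nat),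
  W1 S k1 a -> W1 S k2 b ->
  exists nl : nat -> nat, [/\ nondecreasing_seq nl, nl @ \oo --> \oo &
    forall l, W1 S (nl l + k1) b /\
      (@cyl S k1 [:: a] `&` @Titer S k1 (nl l) @^-1` cyl [:: b]) !=set0].

Definition mixing_shift S := transitive_shift S /\
  forall (k1 k2 a b : nat), W1 S k1 a -> W1 S k2 b ->
  exists N : nat, forall n, (N <= n)%N -> W1 S (n + k1) b ->
    (@cyl S k1 [:: a] `&` @Titer S k1 n @^-1` cyl [:: b]) !=set0.

(* Big preimages, with the witnesses I and K made explicit since the constants
   below depend on them. *)
Definition big_preimages S (I K : set nat) :=
  [/\ mixing_shift S, finite_set I, infinite_set K,
    forall n, K n -> (0 < n)%N &
    forall n a, K n -> W1 S n a ->
      exists b, [/\ I b, W1 S n.-1 b & words S n.-1 2 [:: b; a]]].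

Section with_real.
Variable R : realType.
Variable S : nsshift.

Lemma neq_letter n (x y : Sig S n) : x <> y -> exists i, x i != y i.
Proof.
move=> xy; apply: contrapT => h; apply: xy; apply: val_inj; apply: funext => i.
by apply/eqP/negPn/negP => xyi; apply: h; exists i.
Qed.

Definition dr (r : R) n (x y : Sig S n) : R :=
  match pselect (x = y) with
  | left _ => 0
  | right xy => r ^+ ex_minn (neq_letter xy)
  end.

Definition variation n (k : nat) (f : Sig S n -> R) : \bar R :=
  ereal_sup [set e | exists a (x y : Sig S n),
    [/\ words S n k a, cyl a x, cyl a y & e = (`|f x - f y|)%:E]].

Definition holder_consts (r : R) (m : nat) n (f : Sig S n -> R) : set R :=
  [set kappa | 0 <= kappa /\ forall k, (m <= k)%N ->
    (variation k f <= (kappa * r ^+ k)%:E)%E].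

Definition locally_holder r m n (f : Sig S n -> R) :=
  holder_consts r m f !=set0.

Definition holder_const r m n (f : Sig S n -> R) : R :=
  inf (holder_consts r m f).

Definition holder r n (f : Sig S n -> R) :=
  (exists m, locally_holder r m f) /\
  (ereal_sup [set (`|f x|)%:E | x in [set: Sig S n]] < +oo)%E.

(* Unordered real sum of an absolutely summable family. *)
Definition usum (T : choiceType) (D : set T) (a : T -> R) : R :=
  fine (\esum_(y in D) (Num.max (a y) 0)%:E)
  - fine (\esum_(y in D) (Num.max (- a y) 0)%:E).

Definition ruelle n (phi f : Sig S n -> R) (x : Sig S n.+1) : R :=
  usum [set y | Tmap y = x] (fun y => expR (phi y) * f y).

Fixpoint ruellen (phi : forall n, Sig S n -> R) k n (f : Sig S k -> R) :
    Sig S (n + k) -> R :=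
  match n return Sig S (n + k) -> R with
  | 0 => f
  | n'.+1 => @ruelle (n' + k) (phi (n' + k)%N) (@ruellen phi k n' f)
  end.

Arguments ruellen phi {k} n f x.

Definition birkhoff (phi : forall n, Sig S n -> R) k (n : nat) (x : Sig S k)
    : R :=
  \sum_(i < n) phi (i + k)%N (Titer i x).

(* The measure (L_k^n)^* mu, as a set function: its value at A is given by
   the duality relation [int f d(L_k^n)^* mu = int L_k^n f dmu] for f = 1_A. *)
Definition ruellen_dual (phi : forall n, Sig S n -> R) k n
    (mu : probability (Sig S (n + k)) R) (A : set (Sig S k)) : \bar R :=
  (\int[mu]_x (ruellen phi n (\1_A) x)%:E)%E.

Definition property_Hstar (r : R) (phi : forall n, Sig S n -> R)
    (I K : set nat) :=
  [/\ big_preimages S I K,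
    forall n x, ruelle (phi n) (fun=> 1) x = 1,
    forall n, ~ K n -> locally_holder r 2 (phi n) &
    forall n, K n -> locally_holder r 1 (phi n)].

Definition Bcst (r : R) (phi : forall n, Sig S n -> R) (k : nat) : R :=
  expR (\sum_(1 <= i < k.+1) holder_const r 2 (phi (k - i)%N) * r ^+ i).

Definition alpha (r beta : R) (phi : forall n, Sig S n -> R) (k : nat) : R :=
  Bcst r phi k / beta.

Definition dbar (r beta : R) (phi : forall n, Sig S n -> R) k (x y : Sig S k)
    : R :=
  Num.min 1 (alpha r beta phi k * dr r x y).

(* The supremum is taken in [0, +oo], so that it is 0 on a singleton. *)
Definition Dbar (r beta : R) (phi : forall n, Sig S n -> R) k
    (f : Sig S k -> R) : \bar R :=
  maxe 0%E (ereal_sup [set e | exists x y : Sig S k,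
    x <> y /\ e = (`|f x - f y| / dbar r beta phi x y)%:E]).

(* The Borel sigma-algebra of Sigma_k^2 is the product sigma-algebra, since
   Sigma_k is second countable. *)
Definition coupling k (mu nu : set (Sig S k) -> \bar R) :
    set (probability (Sig S k * Sig S k)%type R) :=
  [set m | forall A, measurable A ->
    m (A `*` [set: Sig S k]) = mu A /\ m ([set: Sig S k] `*` A) = nu A].

Definition Wass (r beta : R) (phi : forall n, Sig S n -> R) k
    (mu nu : set (Sig S k) -> \bar R) : \bar R :=
  ereal_inf [set (\int[m]_z (dbar r beta phi z.1 z.2)%:E)%E
    | m in coupling mu nu].

(* The (i, j) entry of A_k ... A_(k + n - 1). *)
Fixpoint alph_prod (k n i j : nat) : \bar R :=
  if n is n'.+1
  then (\esum_(l in W1 S (n' + k))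
         (alph_prod k n' i l * ((alph S (n' + k) l j)%:R)%:E))%E
  else (((i == j)%:R)%:E).

Definition reaches (I K : set nat) (k o n : nat) :=
  [/\ (1 <= n)%N, K (n + k)%N &
    forall j, I j -> W1 S (n.-1 + k) j -> (1 <= alph_prod k n.-1 o j)%E].

Definition least_reaching I K k o m :=
  reaches I K k o m /\ forall n, reaches I K k o n -> (m <= n)%N.

Definition Ccst (phi : forall n, Sig S n -> R) k m
    (u : Sig S (m + k) -> seq nat)
    (hu : forall x, (@Titer S k m @` cyl (u x)) x) : R :=
  inf [set expR (birkhoff phi m (tau (hu x))) | x in [set: Sig S (m + k)]].

End with_real.

Arguments ruellen {R S} phi {k} n f x.

(* Main.v *)
From HB Require Import structures.
Require Import Defs.
From mathcomp Require Import all_boot all_order all_algebra.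
From mathcomp Require Import all_classical all_reals all_analysis.
From mathcomp Require Import measurable_realfun giry zify ring lra.

Set Implicit Arguments.
Unset Strict Implicit.
Unset Printing Implicit Defensive.

Import Order.TTheory GRing.Theory Num.Theory.
Import numFieldNormedType.Exports.

Local Open Scope classical_set_scope.
Local Open Scope ring_scope.

(** All four estimates come from one measurable family of couplings.  Writing
    [L^n f x] as the sum over words [V] of [p_x(V) f(Vx)], where [p_x(V)] is
    [exp (S_n phi (Vx))] on admissible [Vx] and [0] elsewhere, one looks for
    couplings of [p_x] and [p_y], measurable in [(x, y)], whose average cost
    for [dbar_k] is at most [t * dbar_{k+n}(x, y)].  Integrating such a family
    against a coupling of [mu] and [nu] gives a coupling of their images, hence
    the Wasserstein bounds; averaging [f(Vx) - f(Wy)] gives the Lipschitz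
    bounds.
    A coupling is obtained from a common part [e <= p_x, p_y] of mass [c] by
    coupling the residues independently, at cost at most [1 - c].  When
    [dbar(x, y) < 1], bounded distortion gives
    [p_x >= exp (- d_r(x, y) ln B) p_y], and the common part applies the same
    word to [x] and [y].  When [dbar(x, y) = 1], nothing is common for the
    estimates over [n_k] steps; over [m + n_k] steps one first applies to [x]
    and to [y] words of length [m] starting with the letter [o] and of weight
    at least [C], and then the same word to the two resulting points, whose
    first letters agree. *)

(** * Sums over countable sets and completion of a partial coupling *)

Section esum_lemmas.
Context {R : realType}.
Local Open Scope ereal_scope.

Lemma le_term_esum (T : choiceType) (D : set T) (a : T -> \bar R) t :
  D t -> (forall i, D i -> 0 <= a i) -> a t <= \esum_(i in D) a i.
Proof.
move=> Dt a0; rewrite -[leLHS](@esum_set1 R T t a) ?a0//.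
apply: esum_ge; exists [set t]; first by split=> // _ ->.
by rewrite esum_fset// => i; rewrite inE => ->; exact: a0.
Qed.

Lemma esumZl (T : choiceType) (D : set T) (a : T -> \bar R) (c : R) :
  (0 <= c)%R -> (forall i, 0 <= a i) ->
  \esum_(i in D) (c%:E * a i) = c%:E * \esum_(i in D) a i.
Proof.
rewrite le0r => /orP[/eqP ->|c0] a0.
  by rewrite mul0e esum1// => i _; rewrite mul0e.
rewrite /esum -ereal_sup_pZl//; congr ereal_sup.
by rewrite predeqE => x; split=> [[A DA <-]|[_ [A DA <-] <-]];
  [exists (\sum_(i \in A) a i); [exists A|] | exists A];
  rewrite ?ge0_mule_fsumr.
Qed.

Lemma esum_only (T : choiceType) (a : T -> \bar R) t : 0 <= a t ->
  (forall i, i <> t -> a i = 0) -> \esum_(i in [set: T]) a i = a t.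
Proof.
move=> a0 az; rewrite -[RHS](@esum_set1 R T t a)// [RHS]esum_mkcond.
by apply: eq_esum => i _; case: ifPn => //; rewrite notin_setE => /az.
Qed.

Lemma esum_exchange (T T' : choiceType) (a : T -> T' -> \bar R) :
  (forall i j, 0 <= a i j) ->
  \esum_(i in [set: T]) \esum_(j in [set: T']) a i j =
  \esum_(j in [set: T']) \esum_(i in [set: T]) a i j.
Proof.
move=> a0; rewrite !esum_esum//.
rewrite (reindex_esum ([set: T'] `*`` fun=> [set: T]) _ (fun x => (x.2, x.1)))//.
split=> //; first by move=> [i1 i2] [j1 j2] /= _ _ [] -> ->.
by move=> [i j] _; exists (j, i).
Qed.

Lemma esum_inj (T T' : choiceType) (g : T -> T') (a : T' -> \bar R) :
  injective g -> (forall j, ~ range g j -> a j = 0) ->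
  \esum_(j in [set: T']) a j = \esum_(i in [set: T]) a (g i).
Proof.
move=> gi a0; rewrite -(esum_image _ g a); last by move=> ? ? _ _ /gi.
rewrite [RHS]esum_mkcond; apply: eq_esum => i _.
by case: ifPn => //; rewrite notin_setE => /a0.
Qed.

Section completion.
Variables (T : choiceType) (p q : T -> R) (e : T -> T -> R) (a b : T -> R).
Variable c : R.

(* When [c = 1] the residues vanish, and so does their quotient by [1 - c = 0]. *)
Definition completed v w : R :=
  (e v w + (p v - a v) * (q w - b w) / (1 - c))%R.
End completion.

(** By this symmetry the second marginal of a completion is an instance of [esum_completed]. *)
Lemma completedC (T : choiceType) (p q : T -> R) e a b c v w :
  completed p q e a b c v w = completed q p (fun v w => e w v) b a c w v.
Proof. by rewrite /completed [((p v - a v) * _)%R]mulrC. Qed.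

Section completion_theory.
Variables (T : choiceType) (p q : T -> R) (e : T -> T -> R) (a b : T -> R).
Variable c : R.
Hypotheses (p1 : \esum_(v in [set: T]) (p v)%:E = 1)
  (q1 : \esum_(v in [set: T]) (q v)%:E = 1)
  (e0 : forall v w, (0 <= e v w)%R)
  (ea : forall v, \esum_(w in [set: T]) (e v w)%:E = (a v)%:E)
  (eb : forall w, \esum_(v in [set: T]) (e v w)%:E = (b w)%:E)
  (ec : \esum_(v in [set: T]) (a v)%:E = c%:E)
  (ap : forall v, (a v <= p v)%R) (bq : forall v, (b v <= q v)%R).

Let a0 v : (0 <= a v)%R.
Proof. by rewrite -lee_fin -ea; apply: esum_ge0 => *; rewrite lee_fin. Qed.
Let b0 v : (0 <= b v)%R.
Proof. by rewrite -lee_fin -eb; apply: esum_ge0 => *; rewrite lee_fin. Qed.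

Lemma esum_marginal2 : \esum_(v in [set: T]) (b v)%:E = c%:E.
Proof.
rewrite -ec; under eq_esum do rewrite -eb; rewrite esum_exchange//.
  by under eq_esum do rewrite ea.
by move=> i j; rewrite lee_fin.
Qed.

(** Adding [c] back gives total mass 1, which forces the residual sum to be finite; no subtraction
    of extended reals occurs. *)
Lemma esum_residual (p' a' : T -> R) :
  (forall v, 0 <= a' v)%R -> (forall v, a' v <= p' v)%R ->
  \esum_(v in [set: T]) (p' v)%:E = 1 ->
  \esum_(v in [set: T]) (a' v)%:E = c%:E ->
  \esum_(v in [set: T]) (p' v - a' v)%:E = (1 - c)%:E.
Proof.
move=> a'0 ap' p'1 a'c.
have : \esum_(v in [set: T]) (p' v - a' v)%:E + c%:E = 1.
  rewrite -p'1 -a'c -esumD; last 2 first.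
  - by move=> i _; rewrite lee_fin subr_ge0.
  - by move=> i _; rewrite lee_fin.
  by apply: eq_esum => i _; rewrite -EFinD subrK.
case: (\esum_(v in _) _) => [s| |]//; rewrite -EFinD => -[] <-.
by rewrite addrK.
Qed.

Let c1 : (0 <= 1 - c)%R.
Proof.
by rewrite -lee_fin -(esum_residual a0 ap p1 ec); apply: esum_ge0 => i _;
  rewrite lee_fin subr_ge0.
Qed.

Lemma completed_ge0 v w : (0 <= completed p q e a b c v w)%R.
Proof. by rewrite addr_ge0// divr_ge0// mulr_ge0// subr_ge0. Qed.

Let esum_residualM v :
  \esum_(w in [set: T]) ((p v - a v) * (q w - b w) / (1 - c))%:E
  = (p v - a v)%:E.
Proof.
have pa : (0 <= p v - a v)%R by rewrite subr_ge0.
under eq_esum do rewrite mulrAC EFinM.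
rewrite esumZl ?divr_ge0//; last by move=> i; rewrite lee_fin subr_ge0.
rewrite (esum_residual b0 bq q1 esum_marginal2) -EFinM.
(* If [c = 1], the nonnegative residues [p v - a v] have total mass 0, so each of them vanishes and
   both sides are 0. *)
have [c10|?] := eqVneq (1 - c)%R 0%R; last by rewrite mulfVK.
suff -> : (p v - a v)%R = 0%R by rewrite !mul0r.
apply/eqP; rewrite eq_le pa andbT -lee_fin.
rewrite -[leRHS]/((0:R)%:E) -c10 -(esum_residual a0 ap p1 ec).
by apply: (le_term_esum (a := fun v => (p v - a v)%:E)) => // i _;
  rewrite lee_fin subr_ge0.
Qed.

Let resM_ge0 v w : (0 <= (p v - a v) * (q w - b w) / (1 - c))%R.
Proof. by rewrite divr_ge0// mulr_ge0// subr_ge0. Qed.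

Lemma esum_completed v :
  \esum_(w in [set: T]) (completed p q e a b c v w)%:E = (p v)%:E.
Proof.
under eq_esum do rewrite EFinD.
rewrite esumD ?esum_residualM ?ea -?EFinD ?subrKC// => i _; rewrite lee_fin//.
Qed.

(** The common part has mass [c] and costs at most [s] per unit of mass; on the product of the
    residues, of mass [1 - c], only [k <= 1] is used. *)
Lemma esum_completed_cost (k : T -> T -> R) (s : R) : (0 <= s)%R ->
  (forall v w, 0 <= k v w <= 1)%R ->
  (forall v w, e v w * k v w <= e v w * s)%R ->
  \esum_(v in [set: T]) \esum_(w in [set: T])
     (completed p q e a b c v w * k v w)%:E <= (c * s + (1 - c))%:E.
Proof.
move=> s0 k01 ks.
apply: (@le_trans _ _ (\esum_(v in [set: T]) \esum_(w in [set: T])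
  (s%:E * (e v w)%:E + ((p v - a v) * (q w - b w) / (1 - c))%:E))).
  apply: le_esum => v _; apply: le_esum => w _.
  rewrite -EFinM -EFinD lee_fin /completed mulrDl lerD//.
    by rewrite (le_trans (ks _ _))// mulrC.
  by rewrite ler_piMr//; case/andP: (k01 v w).
under eq_esum => v _.
  rewrite esumD; [|by move=> w _; rewrite -EFinM lee_fin mulr_ge0|
    by move=> w _; rewrite lee_fin].
  rewrite esumZl//; last by move=> w; rewrite lee_fin.
  rewrite ea esum_residualM; over.
rewrite esumD; [|by move=> w _; rewrite -EFinM lee_fin mulr_ge0|
    by move=> w _; rewrite lee_fin subr_ge0].
rewrite esumZl//.
by rewrite ec (esum_residual a0 ap p1 ec) -EFinM -EFinD mulrC.
Qed.

End completion_theory.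
End esum_lemmas.

(** * Integration of a family of discrete probabilities *)

(** Turns unordered sums over a countable type into series along its enumeration, the form in which
    series of measures and of measurable functions are handled. *)
Lemma nneseries_pickle (R : realType) (T : countType) (a : T -> \bar R) :
  (forall t, 0 <= a t)%E ->
  (\sum_(j <oo) oapp a 0 (pickle_inv j) = \esum_(t in [set: T]) a t)%E.
Proof.
move=> a0; rewrite nneseries_esumT; last by move=> n; case: pickle_inv => /=.
rewrite (esum_inj (g := @pickle T)); last 2 first.
- exact: (pcan_inj pickleK_inv).
- move=> j jr; case E : (pickle_inv j) => [t|]//=; exfalso; apply: jr.
  by exists t => //; have := @pickle_invK T j; rewrite E.
by apply: eq_esum => t _; rewrite pickleK_inv.
Qed.

Section discrete_kernel.
Context d d' (X : measurableType d) (Y : measurableType d') (R : realType).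
Context (J : countType) (c : J -> X -> R) (g : J -> X -> Y).
Hypotheses (c0 : forall t x, 0 <= c t x)
  (mc : forall t, measurable_fun [set: X] (c t))
  (mg : forall t, measurable_fun [set: X] (g t))
  (c1 : forall x, (\esum_(t in [set: J]) (c t x)%:E = 1)%E).
Local Open Scope ereal_scope.

Let atom x (j : nat) : {measure set Y -> \bar R} :=
  if pickle_inv j is Some t then mscale (NngNum (c0 t x)) (\d_(g t x))
  else mzero.

Let disc x := mseries (atom x) 0.
HB.instance Definition _ x := Measure.on (disc x).

Let discE x A : disc x A =
  \esum_(t in [set: J]) (c t x)%:E * \d_(g t x) A.
Proof.
rewrite -nneseries_pickle; last first.
  by move=> t; rewrite mule_ge0// lee_fin.
by rewrite /disc /mseries; apply: eq_eseriesr => j _; rewrite /atom;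
  case: pickle_inv.
Qed.

Let disc_setT x : disc x setT <= 1.
Proof.
rewrite discE; under eq_esum do rewrite diracT mule1.
by rewrite c1.
Qed.

HB.instance Definition _ x :=
  Measure_isSubProbability.Build _ _ _ (disc x) (disc_setT x).

Let kernel x : giry Y R := disc x.

Let integral_kernel x (F : Y -> \bar R) :
  measurable_fun [set: Y] F -> (forall y, 0 <= F y) ->
  \int[kernel x]_y F y = \esum_(t in [set: J]) (c t x)%:E * F (g t x).
Proof.
move=> mF F0; rewrite /kernel.
rewrite [LHS](@ge0_integral_measure_series _ _ _ (atom x))//.
rewrite -nneseries_pickle; last by move=> t; rewrite mule_ge0// lee_fin.
apply: eq_eseriesr => j _; rewrite /atom; case: pickle_inv => [t|]/=.
  by rewrite ge0_integral_mscale//= integral_dirac// diracT mul1e.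
by rewrite integral_measure_zero.
Qed.

Lemma emeasurable_esum (F : J -> X -> \bar R) :
  (forall t x, 0 <= F t x) -> (forall t, measurable_fun [set: X] (F t)) ->
  measurable_fun [set: X] (fun x => \esum_(t in [set: J]) F t x).
Proof.
move=> F0 mF; rewrite [X in measurable_fun _ X](_ : _ =
    (fun x => \sum_(j <oo) oapp (F ^~ x) 0 (pickle_inv j))).
  apply: ge0_emeasurable_sum => [k x _ _|k _]; first by case: pickle_inv => /=.
  by case: pickle_inv => //= t; exact: mF.
by apply/funext => x; rewrite nneseries_pickle.
Qed.

Let measurable_kernel : measurable_fun [set: X] kernel.
Proof.
apply: measurable_giry_codensity => // B mB.
rewrite (_ : kernel ^~ B = (fun x => \esum_(t in [set: J])
    (c t x)%:E * \d_(g t x) B)); last by apply/funext => x; exact: discE.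
apply: emeasurable_esum => [t x|t]; first by rewrite mule_ge0// lee_fin.
apply: emeasurable_funM; first exact/measurable_EFinP.
under eq_fun do rewrite diracE.
by apply: (measurableT_comp (measurable_fun_dirac mB)).
Qed.

Let bind (m : probability X R) : giry Y R := giry_bind m measurable_kernel.

Let integral_bind m F : measurable_fun [set: Y] F -> (forall y, 0 <= F y) ->
  \int[bind m]_y F y = \int[m]_x \esum_(t in [set: J]) (c t x)%:E * F (g t x).
Proof.
move=> mF F0; have := giry_int_bind m measurable_kernel mF F0.
rewrite /giry_int => ->.
by apply: eq_integral => x _; rewrite integral_kernel.
Qed.

Let bind_setT m : bind m setT = 1.
Proof.
have := @integral_bind m (cst 1) (measurable_cst _) (fun=> lee01).
rewrite integral_cst// mul1e => ->.
under eq_integral => x _.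
  under eq_esum do rewrite /cst mule1.
  rewrite c1; over.
by rewrite integral_cst// mul1e; exact: probability_setT.
Qed.

Let bindP (m : probability X R) : set Y -> \bar R := bind m.
HB.instance Definition _ m := Measure.on (bindP m).
HB.instance Definition _ m :=
  Measure_isProbability.Build _ _ _ (bindP m) (bind_setT m).

(** [M] is the bind of the Giry monad: draw [x] from [m], then [t] with weight [c t x], and return
    [g t x]. With pairs of words as [t], this integrates a family of couplings against a
    coupling. *)
Lemma discrete_kernel_comp (m : probability X R) :
  exists M : probability Y R, forall F : Y -> \bar R,
    measurable_fun [set: Y] F -> (forall y, 0 <= F y) ->
  \int[M]_y F y = \int[m]_x \esum_(t in [set: J]) (c t x)%:E * F (g t x).
Proof. by exists (bindP m) => F; exact: integral_bind. Qed.

End discrete_kernel.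

(** * Topology and measurability on the shift spaces *)

Definition agree (N : nat) (x y : nat -> nat) := forall i, (i < N)%N -> x i = y i.

Section topology.
Variable S : nsshift.

Lemma open_cylP n (A : set (Sig S n)) : open A <->
  forall x, A x -> exists N, forall y : Sig S n, agree N x y -> A y.
Proof.
split=> [[B oB <-] x Bx|h].
  (* If no cylinder around [x] fits into the open set, points outside it that agree with [x] on [N]
     letters converge pointwise to [x], a contradiction. *)
  apply: contrapT => /forallNP h.
  have /choice[y hy] N : exists y : Sig S n, agree N x y /\ ~ B (set_val y).
    by have /existsNP[y /not_implyP] := h N; exists y.
  have : (fun N => letter (y N) : {ptws nat -> nat}) @ \oo -->
      (letter x : {ptws nat -> nat}).
    apply/pointwise_cvgP => i.
    change ((fun N => y N i) @ \oo --> letter x i); apply: cvg_near_cst.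
    near=> N; apply: (esym ((hy N).1 i _)); near: N.
    exact: nbhs_infty_gt.
  move=> /(_ B) []; first exact: open_nbhs_nbhs.
  by move=> N _ /(_ N (leqnn N)) /=; exact: (hy N).2.
rewrite openE => x Ax; have [N hN] := h x Ax.
have prx i : nbhs x [set y : Sig S n | y i = letter x i].
  have c : continuous (fun y : Sig S n => letter y i).
    move=> z; apply: (@continuous_comp _ {ptws nat -> nat} _ set_val (fun f => f i)).
      exact: initial_continuous.
    exact: (@proj_continuous _ (fun=> nat) i).
  by have := c x [set letter x i] (discrete_set1 _).
have : nbhs x [set y : Sig S n | agree N (letter x) y].
  elim: (N) => [|M IH]; first by apply: filterS filterT => y _ i.
  apply: filterS (filterI IH (prx M)) => y /= [hy yM] i.
  by rewrite ltnS leq_eqVlt => /orP[/eqP->|/hy].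
by apply: filterS => y /hN.
Unshelve. all: by end_near. Qed.

Lemma open_measurable_Sig n (A : set (Sig S n)) : open A -> measurable A.
Proof. by move=> oA; apply: sub_sigma_algebra. Qed.

Lemma measurable_cylP n (A : set (Sig S n)) :
  (forall x : Sig S n, A x -> exists N, forall y : Sig S n, agree N x y -> A y) ->
  measurable A.
Proof. by move=> /open_cylP; exact: open_measurable_Sig. Qed.

Lemma measurable_fun_Sig m n (g : Sig S m -> Sig S n) :
  (forall (x : Sig S m) N, exists M, forall y : Sig S m,
    agree M x y -> agree N (g x) (g y)) ->
  measurable_fun [set: Sig S m] g.
Proof.
move=> h; apply: (measurability (@open (Sig S n))) => //.
move=> _ [A oA <-]; rewrite setTI; apply: measurable_cylP => x /= Agx.
have [N hN] := (open_cylP A).1 oA _ Agx.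
by have [M hM] := h x N; exists M => y /hM /hN.
Qed.

Lemma measurable_fun_SigR (R : realType) m (h : Sig S m -> R) :
  (forall (x : Sig S m) (e : R), 0 < e ->
     exists M, forall y : Sig S m, agree M x y -> `|h x - h y| < e) ->
  measurable_fun [set: Sig S m] h.
Proof.
move=> hh mT; apply: (measurability _ (RGenOpens.measurableE R)) => //.
move=> _ [_ [a [b ->]] <-]; rewrite setTI; apply: measurable_cylP => x /=.
rewrite in_itv/= => /andP[ax xb].
have e0 : 0 < Num.min (h x - a) (b - h x) by rewrite lt_min !subr_gt0 ax.
have [N hN] := hh x _ e0; exists N => y /hN.
rewrite lt_min !ltr_norml in_itv/= => /andP[/andP[? ?] /andP[? ?]].
by apply/andP; split; lra.
Qed.
End topology.

Section words_and_points.
Variable S : nsshift.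

(* The value off the admissible sequences is irrelevant. *)
Definition sig_of k (z : nat -> nat) : Sig S k :=
  match pselect ((z : {ptws nat -> nat}) \in @admissible S k) with
  | left h => exist _ (z : {ptws nat -> nat}) h
  | right _ => point
  end.

Lemma letter_sig_of k z : @admissible S k z -> letter (sig_of k z) = z.
Proof. by rewrite /sig_of => zk; case: pselect => // -[]; exact/mem_set. Qed.

Lemma admissible_letter k (x : Sig S k) : @admissible S k (letter x).
Proof. exact: (set_mem (valP x)). Qed.

Lemma letter_inj k (x y : Sig S k) : letter x = letter y -> x = y.
Proof. exact: val_inj. Qed.

Lemma sig_of_letter k (x : Sig S k) : sig_of k (letter x) = x.
Proof. by apply: letter_inj; rewrite letter_sig_of//; exact: admissible_letter. Qed.

Definition prepend (V : seq nat) (x : nat -> nat) (i : nat) : nat :=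
  if (i < size V)%N then nth 0%N V i else x (i - size V)%N.

Definition seq_shift (n : nat) (x : nat -> nat) (i : nat) : nat := x (i + n)%N.

Lemma prepend_nil x : prepend [::] x = x.
Proof. by apply/funext => i; rewrite /prepend/= subn0. Qed.

Lemma prepend_cat V W x : prepend (V ++ W) x = prepend V (prepend W x).
Proof.
apply/funext => i; rewrite /prepend size_cat nth_cat.
case: (ltnP i (size V)) => iV; first by rewrite ltn_addr.
by rewrite -ltn_subLR// subnDA.
Qed.

Lemma seq_shift_prepend n V x : (n <= size V)%N ->
  seq_shift n (prepend V x) = prepend (drop n V) x.
Proof.
move=> nV; apply/funext => i; rewrite /seq_shift /prepend size_drop nth_drop.
rewrite ltn_subRL addnC; case: ltnP => // Vi.
by congr x; rewrite subnBA// addnC.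
Qed.

Lemma seq_shift_prepend_size V x : seq_shift (size V) (prepend V x) = x.
Proof. by rewrite seq_shift_prepend// drop_size prepend_nil. Qed.

Lemma admissible_seq_shift n k x :
  @admissible S k x -> @admissible S (n + k) (seq_shift n x).
Proof. by move=> xk i; rewrite addnA; exact: xk. Qed.

(** The tail is admissible by itself, and the junction with [V] sees only its first letter. *)
Lemma admissible_prepend_eq k m V x y : (size V + k)%N = m ->
  @admissible S m x -> @admissible S m y -> x 0%N = y 0%N ->
  @admissible S k (prepend V x) -> @admissible S k (prepend V y).
Proof.
move=> <- _ ym xy xk i; have := xk i; rewrite /prepend.
case: (ltnP i (size V)) => iV; last first.
  move=> _; rewrite ltnNge leqW//= subSn//.
  by have := ym (i - size V)%N; rewrite addnA subnK.
rewrite /=; case: (ltnP i.+1) => // iV'.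
by have -> : (i.+1 - size V)%N = 0%N; [apply/eqP; rewrite subn_eq0|rewrite xy].
Qed.

(** Default values make the branch total; wherever they occur, the weight [branchw] is 0. *)
Definition branch (k n : nat) (V : seq nat) (x : nat -> nat) : Sig S k :=
  if size V == n then sig_of k (prepend V x) else point.

Lemma measurable_sig_of_prepend k n V : size V = n ->
  measurable_fun [set: Sig S (n + k)] (fun x => sig_of k (prepend V (letter x))).
Proof.
(* With [N.+1] the first letters agree even for [N = 0]; they decide whether [sig_of] takes its
   default value. *)
move=> Vn; apply: measurable_fun_Sig => x N; exists N.+1 => y xy.
have xy0 : x 0%N = y 0%N by exact: xy.
have E (x' y' : Sig S (n + k)) : x' 0%N = y' 0%N ->
    @admissible S k (prepend V x') -> @admissible S k (prepend V y').
  by apply: admissible_prepend_eq; rewrite ?Vn//; exact: admissible_letter.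
have [xk|xk] := pselect (@admissible S k (prepend V x)).
  rewrite !letter_sig_of//; last exact: E xk.
  move=> i iN; rewrite /prepend; case: ifP => // _; apply: xy.
  by rewrite ltnS (leq_trans (leq_subr _ _))// ltnW.
rewrite /sig_of; case: pselect => [/set_mem//|_].
by case: pselect => [/set_mem/(E _ _ (esym xy0))//|].
Qed.

Lemma measurable_branch k n V :
  measurable_fun [set: Sig S (n + k)] (fun x => branch k n V (letter x)).
Proof.
rewrite /branch; case: eqP => [|_]; first exact: measurable_sig_of_prepend.
exact: measurable_cst.
Qed.

Lemma measurable_letter n i (b : nat) : measurable [set x : Sig S n | x i = b].
Proof.
by apply: measurable_cylP => x /= xb; exists i.+1 => y xy; rewrite -xb xy.
Qed.

Lemma measurable_admissible_prepend k n V : size V = n ->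
  measurable [set x : Sig S (n + k) | @admissible S k (prepend V (letter x))].
Proof.
move=> Vn; apply: measurable_cylP => x /= xk; exists 1%N => y xy.
apply: admissible_prepend_eq xk; first by rewrite Vn.
- exact: admissible_letter.
- exact: admissible_letter.
- exact: xy.
Qed.

End words_and_points.

(** * Ruelle operators as sums over words *)

Lemma max_le_add (R : realDomainType) (a b : R) :
  0 <= a -> 0 <= b -> Num.max (a - b) 0 <= a + b.
Proof. by move=> a0 b0; rewrite ge_max addr_ge0// lerD2l ge0_cp. Qed.

Section weights.
Variables (R : realType) (S : nsshift) (phi : forall n, Sig S n -> R).
Arguments phi : clear implicits.

(** Birkhoff sums of plain sequences: shifting and prepending words then needs no transport between
    the types [Sig S (i + k)]. *)
Definition birk_sum k n (z : nat -> nat) : R :=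
  \sum_(i < n) phi (i + k)%N (sig_of S (i + k) (seq_shift i z)).

(** These are the weights [p_x(V)]. Extending them by 0 to all words gives the laws for [x] and for
    [y] a common index type. *)
Definition branchw (k n : nat) (V : seq nat) (x : nat -> nat) : R :=
  if (size V == n) && `[< @admissible S k (prepend V x) >]
  then expR (birk_sum k n (prepend V x)) else 0.

Lemma branchw_ge0 k n V x : 0 <= branchw k n V x.
Proof. by rewrite /branchw; case: ifP => // _; exact: expR_ge0. Qed.

Lemma branchw_neq0 k n V x : branchw k n V x <> 0 ->
  size V = n /\ @admissible S k (prepend V x).
Proof. by rewrite /branchw; case: ifP => // /andP[/eqP -> /asboolP]. Qed.

Lemma birk_sumD k m n z :
  birk_sum k (m + n)%N z = birk_sum k n z + birk_sum (n + k)%N m (seq_shift n z).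
Proof.
have phiE a b (y : nat -> nat) : a = b -> phi a (sig_of S a y) = phi b (sig_of S b y).
  by move->.
rewrite /birk_sum addnC big_split_ord/=; congr (_ + _).
apply: eq_bigr => i _; rewrite (phiE _ (i + (n + k))%N); last first.
  by rewrite addnAC addnC addnA.
by congr (phi _ (sig_of S _ _)); apply/funext => j; rewrite /seq_shift addnA addnAC.
Qed.

(** The cocycle identity [birk_sumD], exponentiated: [W] is prepended first, then [V]. Where
    [V ++ W] is admissible before [x], so is its tail [W]. *)
Lemma branchw_cat k m n V W x : size V = n -> size W = m ->
  branchw k (m + n)%N (V ++ W) x =
  branchw (n + k)%N m W x * branchw k n V (prepend W x).
Proof.
move=> Vn Wm; rewrite /branchw size_cat Vn Wm addnC !eqxx/= prepend_cat.
case: asboolP => [VW|_]; last by rewrite mulr0.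
rewrite asboolT; last first.
  by rewrite -[prepend W x](seq_shift_prepend_size V) Vn; exact: admissible_seq_shift.
rewrite birk_sumD expRD mulrC; congr (expR (birk_sum _ _ _) * _).
by rewrite -Vn seq_shift_prepend_size.
Qed.

Lemma letter_Titer k n (y : Sig S k) : letter (Titer n y) = seq_shift n (letter y).
Proof.
elim: n => [|n IH]; first by apply/funext => i; rewrite /seq_shift addn0.
apply/funext => i; rewrite -[LHS]/(letter (Titer n y) i.+1) IH /seq_shift.
by rewrite addSnnS.
Qed.

Lemma birkhoffE k n (y : Sig S k) : birkhoff phi n y = birk_sum k n (letter y).
Proof.
by apply: eq_bigr => i _; rewrite -letter_Titer sig_of_letter.
Qed.

Local Open Scope ereal_scope.

Lemma esum_Tmap k (F : Sig S k -> \bar R) (x : Sig S k.+1) :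
  (forall y, 0 <= F y) ->
  \esum_(y in [set y | Tmap y = x]) F y =
  \esum_(b in [set: nat])
    if `[< @admissible S k (prepend [:: b] x) >] then F (sig_of S k (prepend [:: b] x))
    else 0.
Proof.
move=> F0.
pose D := [set b | @admissible S k (prepend [:: b] x)].
rewrite (reindex_esum D _ (fun b => sig_of S k (prepend [:: b] x))).
  rewrite esum_mkcond; apply: eq_esum => b _.
  by case: asboolP => h; [rewrite mem_set|rewrite memNset].
split.
- move=> b Db /=; apply: letter_inj; apply/funext => i.
  rewrite -[LHS]/(letter (sig_of S k (prepend [:: b] x)) i.+1).
  by rewrite letter_sig_of// /prepend/= subn1.
- move=> b b' /set_mem Db /set_mem Db' /(congr1 (fun y : Sig S k => y 0%N)).
  by rewrite !letter_sig_of.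
- move=> y /= yx.
  have E : prepend [:: letter y 0%N] x = letter y.
    by apply/funext => -[|i]; rewrite -yx /prepend//= subn1.
  exists (letter y 0%N); rewrite ?/D/= E; first exact: admissible_letter.
  exact: sig_of_letter.
Qed.

Hypothesis ruelle1 : forall n x, ruelle (phi n) (fun=> 1%R) x = 1%R.

Lemma esum_exp_phi n (x : Sig S n.+1) :
  \esum_(y in [set y | Tmap y = x]) (expR (phi n y))%:E = 1.
Proof.
have := ruelle1 x; rewrite /ruelle /usum.
under eq_esum do rewrite mulr1 max_l ?expR_ge0//.
under [X in (_ - fine X)%R]eq_esum do rewrite mulr1 max_r ?oppr_le0 ?expR_ge0//.
rewrite [X in (_ - fine X)%R]esum1//= subr0 => h.
have : 0 <= \esum_(y in [set y | Tmap y = x]) (expR (phi n y))%:E.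
  by apply: esum_ge0 => y _; rewrite lee_fin expR_ge0.
(* [fine] sends an infinite sum to 0, so the value 1 excludes divergence. *)
move: h; case: (\esum_(y in _) _) => //= [r -> //|/eqP].
by rewrite eq_sym oner_eq0.
Qed.

Lemma esum_exp_phi_le n (f : Sig S n -> R) (M : R) (x : Sig S n.+1) :
  (forall y, 0 <= f y <= M)%R ->
  0 <= \esum_(y in [set y | Tmap y = x]) (expR (phi n y) * f y)%:E <= M%:E.
Proof.
move=> fM; have M0 : (0 <= M)%R by case/andP: (fM point) => /le_trans; exact.
apply/andP; split.
  by apply: esum_ge0 => y _; rewrite lee_fin mulr_ge0 ?expR_ge0//; case/andP: (fM y).
rewrite -[leRHS]mule1 -(esum_exp_phi x) -esumZl//.
apply: le_esum => y _; rewrite -EFinM lee_fin mulrC ler_wpM2r ?expR_ge0//.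
by case/andP: (fM y).
Qed.

(** [usum] treats positive and negative parts separately. This form of linearity lets a bounded
    signed function be replaced by a nonnegative one plus a constant. *)
Lemma ruelleB n (f : Sig S n -> R) (M c : R) (x : Sig S n.+1) :
  (forall y, 0 <= f y <= M)%R -> (0 <= c)%R ->
  (ruelle (phi n) (fun y => f y - c) x)%:E =
  \esum_(y in [set y | Tmap y = x]) (expR (phi n y) * f y)%:E - c%:E.
Proof.
move=> fM c0; rewrite /ruelle /usum.
pose D := [set y | Tmap y = x].
pose F y := (expR (phi n y) * f y)%:E.
pose G y := (expR (phi n y) * c)%:E.
have F0 y : 0 <= F y.
  by rewrite lee_fin mulr_ge0 ?expR_ge0//; case/andP: (fM y).
have G0 y : 0 <= G y by rewrite lee_fin mulr_ge0 ?expR_ge0.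
have /andP[_ FM] := esum_exp_phi_le x fM.
have cc (y : Sig S n) : (0 <= c <= c)%R by rewrite c0 lexx.
have /andP[_ GM] := esum_exp_phi_le x cc.
have GE : \esum_(y in D) G y = c%:E.
  rewrite -[RHS]mule1 -(esum_exp_phi x) -esumZl//.
  by apply: eq_esum => y _; rewrite -EFinM mulrC.
have sF : summable D F.
  rewrite /summable; under eq_esum do rewrite gee0_abs//.
  by rewrite (le_lt_trans FM)// ltry.
have sG : summable D G.
  rewrite /summable; under eq_esum do rewrite gee0_abs//.
  by rewrite (le_lt_trans GM)// ltry.
have := esumB sF sG (fun y _ => F0 y) (fun y _ => G0 y); rewrite GE => <-.
(* Both parts of [F - G] are dominated by [F + G], whose sum is finite. *)
have fin (H : Sig S n -> \bar R) : (forall y, 0 <= H y) ->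
    (forall y, H y <= F y + G y) -> \esum_(y in D) H y \is a fin_num.
  move=> H0 HFG; rewrite ge0_fin_numE; last by apply: esum_ge0.
  apply: (@le_lt_trans _ _ (\esum_(y in D) (F y + G y))).
    exact: le_esum.
  rewrite esumD// GE (@le_lt_trans _ _ (M%:E + c%:E))//; last first.
    by rewrite -EFinD ltry.
  by rewrite leeD2r.
have E1 y : ((F \- G)^\+ y) = (Num.max (expR (phi n y) * (f y - c)) 0)%:E.
  by rewrite funeposE /= /F /G -EFinD -EFin_max mulrBr.
have E2 y : ((F \- G)^\- y) = (Num.max (- (expR (phi n y) * (f y - c))) 0)%:E.
  by rewrite funenegE /= /F /G /= -EFin_max mulrBr.
rewrite EFinB !fineK.
- by congr (_ - _); apply: eq_esum => y _; rewrite ?E1 ?E2.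
- apply: fin => y; first by rewrite lee_fin le_max lexx orbT.
  by rewrite mulrBr opprB -EFinD lee_fin [leRHS]addrC max_le_add ?F0 ?G0//;
    [exact: G0|exact: F0].
- apply: fin => y; first by rewrite lee_fin le_max lexx orbT.
  by rewrite mulrBr -EFinD lee_fin max_le_add ?F0 ?G0//; [exact: F0|exact: G0].
Qed.

Lemma ruelleE n (f : Sig S n -> R) (M : R) (x : Sig S n.+1) :
  (forall y, 0 <= f y <= M)%R ->
  (ruelle (phi n) f x)%:E =
  \esum_(y in [set y | Tmap y = x]) (expR (phi n y) * f y)%:E.
Proof.
move=> fM; have := ruelleB x fM (lexx 0%R); rewrite sube0 => <-.
by congr (ruelle _ _ _)%:E; apply/funext => y; rewrite subr0.
Qed.

Lemma ruellen_bound k n (f : Sig S k -> R) (M : R) :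
  (forall y, 0 <= f y <= M)%R -> forall x, (0 <= ruellen phi n f x <= M)%R.
Proof.
move=> fM; elim: n => [|n IH] x //=.
by rewrite -!lee_fin (ruelleE x IH); exact: esum_exp_phi_le.
Qed.

Lemma ruellenB k n (f : Sig S k -> R) (M c : R) :
  (forall y, 0 <= f y <= M)%R -> (0 <= c)%R ->
  forall x, ruellen phi n (fun y => f y - c)%R x = (ruellen phi n f x - c)%R.
Proof.
move=> fM c0; elim: n => [//|n IH] x /=.
have -> : ruellen phi n (fun y => f y - c)%R = fun y => (ruellen phi n f y - c)%R.
  by apply/funext.
apply: EFin_inj; rewrite (ruelleB x (ruellen_bound (n := n) fM) c0).
by rewrite EFinB (ruelleE x (ruellen_bound (n := n) fM)).
Qed.

(** Induction on [n]: the outermost operator contributes the letter next to [x], so words grow at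
    their right end, by [rcons]. *)
Lemma ruellenE k n (f : Sig S k -> R) (M : R) (x : Sig S (n + k)) :
  (forall y, 0 <= f y <= M)%R ->
  (ruellen phi n f x)%:E =
  \esum_(V in [set: seq nat]) (branchw k n V x * f (branch S k n V x))%:E.
Proof.
move=> fM; have f0 y : (0 <= f y)%R by case/andP: (fM y).
have pf0 n' V (y : nat -> nat) : 0 <= (branchw k n' V y * f (branch S k n' V y))%:E.
  by rewrite lee_fin mulr_ge0// branchw_ge0.
elim: n x => [|n IH] x /=.
  rewrite (esum_only (t := [::]))//.
    rewrite /branchw /branch/= prepend_nil sig_of_letter asboolT; last first.
      exact: admissible_letter.
    by rewrite /birk_sum big_ord0 expR0 mul1r.
  by case=> // b V _; rewrite /branchw/= mul0r.
rewrite (ruelleE x (ruellen_bound (n := n) fM)) esum_Tmap; last first.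
  move=> y; rewrite lee_fin mulr_ge0 ?expR_ge0//.
  by case/andP: (ruellen_bound (n := n) fM y).
transitivity (\esum_(b in [set: nat]) \esum_(V in [set: seq nat])
    (branchw k n.+1 (rcons V b) x * f (branch S k n.+1 (rcons V b) x))%:E).
  apply: eq_esum => b _; case: asboolP => bx; last first.
    rewrite esum1// => V _; rewrite /branchw; case: ifPn; last by rewrite mul0r.
    rewrite size_rcons -cats1 eqSS => /andP[/eqP Vn /asboolP adm]; exfalso.
    apply: bx; rewrite -[prepend [:: b] x](seq_shift_prepend_size V) -prepend_cat Vn.
    exact: admissible_seq_shift.
  rewrite EFinM IH -esumZl ?expR_ge0//; apply: eq_esum => V _.
  rewrite -EFinM mulrA letter_sig_of//; congr (_%:E).
  have [Vn|Vn] := eqVneq (size V) n; last first.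
    by rewrite /branchw size_rcons eqSS (negbTE Vn)/= mulr0 !mul0r.
  rewrite -cats1 /branch size_cat Vn addn1 !eqxx prepend_cat; congr (_ * _)%R.
  rewrite -[n.+1]/(1 + n)%N branchw_cat//; congr (_ * _)%R.
  rewrite /branchw/= asboolT// /birk_sum big_ord1 add0n.
  by congr (expR (phi _ (sig_of _ _ _))); apply/funext => i; rewrite /seq_shift addn0.
rewrite esum_esum; last by move=> *; exact: pf0.
(* Only the empty word is not of the form [rcons V b], and its weight over [n.+1] steps is 0. *)
rewrite (esum_inj (T := (nat * seq nat)%type)
  (g := fun bV => rcons bV.2 bV.1)); last 2 first.
- by move=> [b V] [b' V'] /= /rcons_inj[-> ->].
- case/lastP => [_|V b h]; first by rewrite /branchw/= mul0r.
  by exfalso; apply: h; exists (b, V).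
rewrite [LHS]esum_mkcond; apply: eq_esum => -[b V] _ /=.
by rewrite mem_set.
Qed.

Lemma ruellen1 k n (x : Sig S (n + k)) :
  ruellen phi n (fun=> 1%R) x = 1%R.
Proof.
elim: n x => [//|n IH] x /=.
by have /funext -> := IH; exact: ruelle1.
Qed.

Lemma esum_branchw k n (x : Sig S (n + k)) :
  \esum_(V in [set: seq nat]) (branchw k n V x)%:E = 1.
Proof.
have b01 (y : Sig S k) : (0 <= (1 : R) <= 1)%R by rewrite ler01 lexx.
rewrite -[RHS]/(1%R%:E) -(ruellen1 (k := k) x) (ruellenE x b01).
by apply: eq_esum => V _; rewrite mulr1.
Qed.

Lemma measurable_branchw k n V : (forall n, measurable_fun [set: Sig S n] (phi n)) ->
  measurable_fun [set: Sig S (n + k)] (fun x => branchw k n V (letter x)).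
Proof.
move=> mphi; rewrite /branchw; case: eqP => /= [Vn|_]; last exact: measurable_cst.
apply: measurable_fun_ifT => //.
  apply: (measurable_fun_bool true); rewrite setTI.
  rewrite [X in measurable X](_ : _ =
    [set x : Sig S (n + k) | @admissible S k (prepend V (letter x))]).
    exact: measurable_admissible_prepend.
  by apply/seteqP; split => x /asboolP.
apply: measurableT_comp; first exact: measurable_expR.
rewrite /birk_sum; apply: measurable_sum => i.
apply: measurableT_comp; first exact: mphi.
under eq_fun do rewrite seq_shift_prepend ?Vn 1?ltnW//.
have -> : (n + k)%N = ((n - i) + (i + k))%N by rewrite addnA subnK// ltnW.
by apply: measurable_sig_of_prepend; rewrite size_drop Vn.
Qed.

End weights.

(** * Separation time and bounded distortion *)

Section separation_time.
Variables (R : realType) (S : nsshift) (r : R).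
Hypothesis r01 : 0 < r < 1.

Let r_gt0 : 0 < r. Proof. by case/andP: r01. Qed.
Let r_ge0 : 0 <= r. Proof. exact: ltW. Qed.
Let r_le1 : r <= 1. Proof. by case/andP: r01 => _ /ltW. Qed.

Lemma drxx n (x : Sig S n) : dr r x x = 0.
Proof. by rewrite /dr; case: pselect. Qed.

Lemma drP n (x y : Sig S n) : x <> y ->
  exists N, [/\ dr r x y = r ^+ N, agree N x y & x N <> y N].
Proof.
move=> xy; rewrite /dr; case: pselect => // xy'.
case: ex_minnP => N /eqP xyN minN; exists N; split => // i iN.
by apply/eqP/negPn/negP => /minN; rewrite leqNgt iN.
Qed.

Lemma dr_ge0 n (x y : Sig S n) : 0 <= dr r x y.
Proof.
have [->|/drP[N [-> _ _]]] := pselect (x = y); first by rewrite drxx.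
exact: exprn_ge0.
Qed.

Lemma dr_gt0 n (x y : Sig S n) : x <> y -> 0 < dr r x y.
Proof. by move=> /drP[N [-> _ _]]; exact: exprn_gt0. Qed.

Lemma dr_le N n (x y : Sig S n) : agree N x y -> dr r x y <= r ^+ N.
Proof.
have [->|/drP[M [-> _ xyM]] xyN] := pselect (x = y).
  by rewrite drxx exprn_ge0.
rewrite ler_wiXn2l//.
by rewrite leqNgt; apply/negP => /xyN.
Qed.

Lemma dr_ge N n (x y : Sig S n) : x N <> y N -> r ^+ N <= dr r x y.
Proof.
move=> xyN; have /drP[M [-> xyM _]] : x <> y by move=> xy; apply: xyN; rewrite xy.
by rewrite ler_wiXn2l// leqNgt; apply/negP => /xyM.
Qed.

Lemma dr_le1 n (x y : Sig S n) : dr r x y <= 1.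
Proof. by rewrite -(expr0 r) dr_le. Qed.

Lemma dr_lt1 n (x y : Sig S n) : dr r x y < 1 -> x 0%N = y 0%N.
Proof.
move=> xy1; apply: contrapT => /dr_ge; rewrite expr0 leNgt xy1.
by [].
Qed.

Lemma dr_contract k m n (V : seq nat) (x y : Sig S m) (x' y' : Sig S k) :
  size V = n -> letter x' = prepend V x -> letter y' = prepend V y ->
  dr r x' y' <= r ^+ n * dr r x y.
Proof.
move=> Vn x'E y'E; have [xy|/drP[N [-> xyN _]]] := pselect (x = y).
  have -> : x' = y' by apply: letter_inj; rewrite x'E y'E xy.
  by rewrite drxx mulr_ge0 ?exprn_ge0 ?dr_ge0.
rewrite -exprD; apply: dr_le => i iN; rewrite x'E y'E /prepend Vn.
by case: ltnP => // ni; rewrite xyN// ltn_subLR.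
Qed.

Lemma measurable_dr n : measurable_fun [set: Sig S n * Sig S n]
  (fun z : Sig S n * Sig S n => dr r z.1 z.2).
Proof.
move=> mT; apply: (measurability _ (RGenOInfty.measurableE R)) => //.
move=> _ [_ [a ->] <-]; rewrite setTI.
have [a0|a0] := ltP a 0.
  rewrite [X in measurable X](_ : _ = setT); first exact: measurableT.
  by apply/seteqP; split => // z _ /=; rewrite in_itv/= andbT (lt_le_trans a0)// dr_ge0.
(* For [a >= 0], the distance exceeds [a] iff the points differ at some index [N] with [a < r ^+ N];
   the first difference serves as witness. *)
rewrite [X in measurable X](_ : _ = \bigcup_(N in [set N | a < r ^+ N])
    ~` \bigcup_b ([set x : Sig S n | x N = b] `*` [set x : Sig S n | x N = b])).
  apply: bigcup_measurable => N _; apply: measurableC.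
  apply: bigcup_measurable => b _.
  by apply: measurableX; exact: measurable_letter.
apply/seteqP; split => -[x y] /=; rewrite in_itv/= andbT.
  move=> axy; have /drP[N [xyE _ xyN]] : x <> y.
    by move=> xy; move: axy; rewrite xy drxx ltNge a0.
  exists N; first by rewrite /= -xyE.
  by move=> [b _ [/= xb yb]]; apply: xyN; rewrite xb.
move=> [N /= aN h]; apply: lt_le_trans aN _; apply: dr_ge => xyN.
by apply: h; exists (x N).
Qed.

End separation_time.

Section distortion.
Variables (R : realType) (S : nsshift) (r : R) (phi : forall n, Sig S n -> R).
Arguments phi : clear implicits.
Hypothesis r01 : 0 < r < 1.
Hypothesis phi2 : forall n, locally_holder r 2 (phi n).

Let r_gt0 : 0 < r. Proof. by case/andP: r01. Qed.
Let r_ge0 : 0 <= r. Proof. exact: ltW. Qed.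
Let r_le1 : r <= 1. Proof. by case/andP: r01 => _ /ltW. Qed.

Lemma holder_const_ge0 n : 0 <= holder_const r 2 (phi n).
Proof. by apply: lb_le_inf; [exact: phi2|move=> x []]. Qed.

(** Every admissible constant gives the bound for the common prefix of length [N]; dividing by
    [r ^+ N > 0] passes it to the infimum. *)
Lemma holder_constP n N (x y : Sig S n) : (2 <= N)%N -> agree N x y ->
  `|phi n x - phi n y| <= holder_const r 2 (phi n) * r ^+ N.
Proof.
move=> N2 xy; have rN : 0 < r ^+ N by exact: exprn_gt0.
rewrite -ler_pdivrMr//; apply: lb_le_inf; first exact: phi2.
move=> kappa [k0 /(_ _ N2)]; rewrite ler_pdivrMr// -lee_fin; apply: le_trans.
apply: ereal_sup_ubound; exists (mkseq x N), x, y; split => //.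
- split; first by rewrite size_mkseq.
  + by move=> i iN; rewrite nth_mkseq//; case: (admissible_letter x i).
  + move=> i iN; rewrite !nth_mkseq//; last exact: ltnW.
    by case: (admissible_letter x i).
- by move=> i; rewrite size_mkseq => iN; rewrite nth_mkseq.
- by move=> i; rewrite size_mkseq => iN; rewrite nth_mkseq// xy.
Qed.

Lemma measurable_potential n : measurable_fun [set: Sig S n] (phi n).
Proof.
apply: measurable_fun_SigR => x e e0.
pose c := holder_const r 2 (phi n).
have : (fun N => c * r ^+ N) @ \oo --> c * 0.
  by apply: cvgMr; apply: cvg_expr; rewrite ger0_norm//; case/andP: r01.
rewrite mulr0 => /cvgrPdist_lt/(_ e e0)[N _ hN].
exists (maxn N 2) => y xy; apply: le_lt_trans (holder_constP _ xy) _.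
  by rewrite leq_maxr.
have := hN (maxn N 2) (leq_maxl _ _); rewrite /= sub0r normrN ger0_norm//.
by rewrite mulr_ge0 ?holder_const_ge0// exprn_ge0.
Qed.

Definition lnB k : R :=
  \sum_(1 <= i < k.+1) holder_const r 2 (phi (k - i)%N) * r ^+ i.

Lemma BcstE k : Bcst r phi k = expR (lnB k). Proof. by []. Qed.

Lemma lnB_ge0 k : 0 <= lnB k.
Proof.
by apply: sumr_ge0 => i _; rewrite mulr_ge0 ?holder_const_ge0// exprn_ge0.
Qed.

(** The left side consists of the first [n] terms of [lnB (n + k)] in reverse order; the remaining
    terms are nonnegative. *)
Lemma sum_holder_const_le k n :
  \sum_(i < n) holder_const r 2 (phi (i + k)%N) * r ^+ (n - i) <= lnB (n + k).
Proof.
rewrite /lnB (@big_cat_nat _ _ _ n.+1)//=; last by rewrite ltnS leq_addr.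
rewrite ler_wpDr//.
  by apply: sumr_ge0 => i _; rewrite mulr_ge0 ?holder_const_ge0// exprn_ge0.
rewrite big_add1/= big_nat_rev/= add0n big_mkord le_eqVlt; apply/orP; left.
apply/eqP; apply: eq_bigr => i _.
have E : (n + k - (n - i) = i + k)%N.
  by have := ltn_ord i; move: (nat_of_ord i) => j; lia.
by rewrite subnSK// E.
Qed.

Lemma birk_sum_distortion k n d V (x y : nat -> nat) : size V = n -> (0 < d)%N ->
  agree d x y -> @admissible S k (prepend V x) ->
  @admissible S k (prepend V y) ->
  `|birk_sum phi k n (prepend V x) - birk_sum phi k n (prepend V y)|
     <= r ^+ d * lnB (n + k).
Proof.
move=> Vn d0 xy xk yk; rewrite /birk_sum -sumrB.
apply: le_trans (ler_norm_sum _ _ _) _.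
apply: (@le_trans _ _ (r ^+ d * \sum_(i < n)
    holder_const r 2 (phi (i + k)%N) * r ^+ (n - i))); last first.
  by rewrite ler_wpM2l ?exprn_ge0// sum_holder_const_le.
rewrite mulr_sumr; apply: ler_sum => i _.
(* In the [i]-th term the sequences agree on [d + (n - i)] letters, at least 2 since [d >= 1] and
   [i < n]; so the Hölder bound of index 2 applies. *)
rewrite mulrCA -exprD; apply: holder_constP.
  by rewrite -(add1n 1) leq_add// subn_gt0.
have ni : (i <= size V)%N by rewrite Vn ltnW.
move=> j jn; rewrite !letter_sig_of; [|exact: admissible_seq_shift..].
rewrite !seq_shift_prepend// /prepend; case: ifP => // /negbT.
rewrite -leqNgt size_drop Vn => ji; apply: xy.
by rewrite ltn_subLR// addnC.
Qed.

(** Equal first letters make [V] admissible before both points or before neither, and the separation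
    time of distinct points at least 1, as [birk_sum_distortion] requires. *)
Lemma branchw_distortion k n V (x y : Sig S (n + k)) : x 0%N = y 0%N ->
  expR (- (dr r x y * lnB (n + k))) * branchw phi k n V y <= branchw phi k n V x.
Proof.
move=> xy0; have [->|xy] := pselect (x = y).
  by rewrite drxx// mul0r oppr0 expR0 mul1r.
have [N [-> xyN xyN']] := drP r xy.
have N0 : (0 < N)%N by case: N xyN xyN'.
rewrite [in leLHS]/branchw; case: ifP => [/andP[/eqP Vn /asboolP yk]|_]; last first.
  by rewrite mulr0 branchw_ge0.
have xk : @admissible S k (prepend V x).
  apply: admissible_prepend_eq yk; first by rewrite Vn.
  - exact: admissible_letter.
  - exact: admissible_letter.
  - by [].
rewrite /branchw Vn eqxx asboolT//= -expRD ler_expR.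
have := birk_sum_distortion Vn N0 xyN xk yk.
rewrite ler_norml => /andP[h _]; lra.
Qed.

End distortion.

(** * From couplings of branches to contraction *)

Section contraction.
Variables (R : realType) (S : nsshift) (r beta : R) (phi : forall n, Sig S n -> R).
Arguments phi : clear implicits.
Hypotheses (r01 : 0 < r < 1) (beta01 : 0 < beta < 1).
Hypothesis phi2 : forall n, locally_holder r 2 (phi n).
Hypothesis ruelle1 : forall n x, ruelle (phi n) (fun=> 1) x = 1.

Local Notation dbar := (dbar r beta phi).
Local Notation alpha := (alpha r beta phi).

Let beta_gt0 : 0 < beta. Proof. by case/andP: beta01. Qed.

Lemma alpha_gt0 k : 0 < alpha k.
Proof. by rewrite divr_gt0// expR_gt0. Qed.

Lemma alpha_gt1 k : 1 < alpha k.
Proof.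
rewrite /alpha BcstE ltr_pdivlMr// mul1r.
case/andP: beta01 => _ /lt_le_trans -> //.
by rewrite -expR0 ler_expR lnB_ge0.
Qed.

Lemma dbar_ge0 k (x y : Sig S k) : 0 <= dbar x y.
Proof. by rewrite le_min ler01 mulr_ge0// ?dr_ge0// ltW// alpha_gt0. Qed.

Lemma dbar_le1 k (x y : Sig S k) : dbar x y <= 1.
Proof. by rewrite ge_min lexx. Qed.

Lemma dbarxx k (x : Sig S k) : dbar x x = 0.
Proof. by rewrite /Defs.dbar drxx mulr0 min_r. Qed.

Lemma dbar_gt0 k (x y : Sig S k) : x <> y -> 0 < dbar x y.
Proof. by move=> xy; rewrite lt_min ltr01 mulr_gt0// ?alpha_gt0// dr_gt0. Qed.

Lemma measurable_dbar k : measurable_fun [set: Sig S k * Sig S k]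
  (fun z : Sig S k * Sig S k => dbar z.1 z.2).
Proof.
apply: measurable_minr; first exact: measurable_cst.
by apply: measurable_funM; [exact: measurable_cst|exact: measurable_dr].
Qed.

Section from_coupling.
Variables (k n : nat) (t : R).
Variable c : seq nat -> seq nat -> Sig S (n + k) -> Sig S (n + k) -> R.
Hypotheses (t0 : 0 < t) (c0 : forall V W x y, 0 <= c V W x y)
  (c1 : forall V x y,
    (\esum_(W in [set: seq nat]) (c V W x y)%:E = (branchw phi k n V x)%:E)%E)
  (c2 : forall W x y,
    (\esum_(V in [set: seq nat]) (c V W x y)%:E = (branchw phi k n W y)%:E)%E)
  (cost : forall x y, (\esum_(V in [set: seq nat]) \esum_(W in [set: seq nat])
    (c V W x y * dbar (branch S k n V x) (branch S k n W y))%:E <= (t * dbar x y)%:E)%E)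
  (mc : forall V W, measurable_fun [set: Sig S (n + k) * Sig S (n + k)]
    (fun z : Sig S (n + k) * Sig S (n + k) => c V W z.1 z.2)).

Local Notation X := (Sig S (n + k)).
Local Open Scope ereal_scope.

Let marginal1 (F : Sig S k -> R) x y : (forall z, 0 <= F z)%R ->
  \esum_(V in [set: seq nat]) \esum_(W in [set: seq nat])
    (c V W x y * F (branch S k n V x))%:E =
  \esum_(V in [set: seq nat]) (branchw phi k n V x * F (branch S k n V x))%:E.
Proof.
move=> F0; apply: eq_esum => V _.
under eq_esum do rewrite mulrC EFinM.
rewrite esumZl//; last by move=> W; rewrite lee_fin.
by rewrite c1 -EFinM mulrC.
Qed.

Let marginal2 (F : Sig S k -> R) x y : (forall z, 0 <= F z)%R ->
  \esum_(V in [set: seq nat]) \esum_(W in [set: seq nat])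
    (c V W x y * F (branch S k n W y))%:E =
  \esum_(W in [set: seq nat]) (branchw phi k n W y * F (branch S k n W y))%:E.
Proof.
move=> F0; rewrite esum_exchange; last by move=> V W; rewrite lee_fin mulr_ge0.
apply: eq_esum => W _; under eq_esum do rewrite mulrC EFinM.
rewrite esumZl//; last by move=> V; rewrite lee_fin.
by rewrite c2 -EFinM mulrC.
Qed.

(** Differences of averages are bounded in the additive form [A <= B + D * K], which makes sense for
    extended sums. *)
Let esum2_le (A B K : seq nat -> seq nat -> R) (D : R) :
  (forall V W, 0 <= B V W)%R -> (forall V W, 0 <= K V W)%R -> (0 <= D)%R ->
  (forall V W, A V W <= B V W + D * K V W)%R ->
  \esum_(V in [set: seq nat]) \esum_(W in [set: seq nat]) (A V W)%:E <=
  \esum_(V in [set: seq nat]) \esum_(W in [set: seq nat]) (B V W)%:E +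
  D%:E * \esum_(V in [set: seq nat]) \esum_(W in [set: seq nat]) (K V W)%:E.
Proof.
move=> B0 K0 D0 ABK; rewrite -esumZl//; last first.
  by move=> V; apply: esum_ge0 => W _; rewrite lee_fin.
rewrite -esumD; last 2 first.
- by move=> V _; apply: esum_ge0 => W _; rewrite lee_fin.
- move=> V _; rewrite mule_ge0//.
  by apply: esum_ge0 => W _; rewrite lee_fin.
apply: le_esum => V _; rewrite -esumZl//; last by move=> W; rewrite lee_fin.
rewrite -esumD; last 2 first.
- by move=> W _; rewrite lee_fin.
- by move=> W _; rewrite -EFinM lee_fin mulr_ge0.
by apply: le_esum => W _; rewrite -EFinM -EFinD lee_fin.
Qed.

Lemma ruellen_lip (f : Sig S k -> R) (M D : R) : (forall z, 0 <= f z <= M)%R ->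
  (0 <= D)%R -> (forall a b, `|f a - f b| <= D * dbar a b)%R -> forall x y,
  (`|ruellen phi n f x - ruellen phi n f y| <= D * (t * dbar x y))%R.
Proof.
move=> fM D0 fD x y.
have f0 z : (0 <= f z)%R by case/andP: (fM z).
have LE z : (ruellen phi n f z)%:E = _ := ruellenE ruelle1 z fM.
have K0 V W : (0 <= c V W x y * dbar (branch S k n V x) (branch S k n W y))%R.
  by rewrite mulr_ge0// dbar_ge0.
have DK : (D%:E * (\esum_(V in [set: seq nat]) \esum_(W in [set: seq nat])
    (c V W x y * dbar (branch S k n V x) (branch S k n W y))%:E)
    <= (D * (t * dbar x y))%:E)%E.
  by rewrite EFinM; apply: lee_wpmul2l; rewrite ?lee_fin.
rewrite ler_distl lerBlDr; apply/andP; split; rewrite -lee_fin EFinD.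
- rewrite !LE -(marginal1 x y f0) -(marginal2 x y f0).
  apply: le_trans; last by apply: leeD2l; exact: DK.
  apply: esum2_le => // V W.
    by rewrite mulr_ge0.
  rewrite mulrCA -mulrDr ler_wpM2l//.
  have := fD (branch S k n V x) (branch S k n W y).
  by rewrite ler_norml => /andP[? ?]; lra.
- rewrite !LE -(marginal1 x y f0) -(marginal2 x y f0).
  apply: le_trans; last by apply: leeD2l; exact: DK.
  apply: esum2_le => // V W.
    by rewrite mulr_ge0.
  rewrite mulrCA -mulrDr ler_wpM2l//.
  have := fD (branch S k n V x) (branch S k n W y).
  by rewrite ler_norml => /andP[? ?]; lra.
Qed.

Lemma Dbar_le (f : Sig S k -> R) (M : R) : (forall z, `|f z| <= M)%R ->
  Dbar r beta phi (ruellen phi n f) <= t%:E * Dbar r beta phi f.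
Proof.
move=> fM; have M0 : (0 <= M)%R by exact: le_trans (fM point).
(* If [Dbar f] is infinite, so is the right side, because [t > 0]. *)
case DE : (Dbar r beta phi f) => [D| |]; last 2 first.
- by rewrite gt0_muley ?leey// lte_fin.
- have : 0 <= Dbar r beta phi f by rewrite /Dbar le_max lexx.
  by rewrite DE.
have D0 : (0 <= D)%R by rewrite -lee_fin -DE /Dbar le_max lexx.
have fD a b : (`|f a - f b| <= D * dbar a b)%R.
  have [->|ab] := pselect (a = b); first by rewrite subrr normr0 dbarxx mulr0.
  rewrite -ler_pdivrMr ?dbar_gt0// -lee_fin -DE /Dbar le_max; apply/orP; right.
  by apply: ereal_sup_ubound; exists a, b.
(* Adding [M] makes the function nonnegative, as the sum formula over words requires; [ruellenB]
   takes the constant out again. *)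
pose g z := (f z + M)%R.
have gM z : (0 <= g z <= M + M)%R.
  by have := fM z; rewrite ler_norml /g => /andP[? ?]; apply/andP; split; lra.
have gD a b : (`|g a - g b| <= D * dbar a b)%R.
  by rewrite /g opprD addrACA subrr addr0.
have LE z : ruellen phi n f z = (ruellen phi n g z - M)%R.
  rewrite -(ruellenB ruelle1 gM M0); congr (ruellen phi n _ z).
  by apply/funext => w; rewrite /g addrK.
rewrite /Dbar ge_max; apply/andP; split.
  by rewrite -EFinM lee_fin mulr_ge0// ltW.
apply: ge_ereal_sup => _ [x [y [xy ->]]].
rewrite -EFinM lee_fin ler_pdivrMr ?dbar_gt0// !LE opprB subrKA.
by rewrite (mulrC t) -mulrA (ruellen_lip gM D0 gD).
Qed.

Let X_fst (m : probability (X * X)%type R) (mu : probability X R)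
    (p : X * X -> X) (mp : measurable_fun [set: X * X] p) (F : X -> \bar R) :
  (forall A, measurable A -> m (p @^-1` A) = mu A) ->
  measurable_fun [set: X] F -> (forall x, 0 <= F x) ->
  \int[m]_z F (p z) = \int[mu]_x F x.
Proof.
move=> mE mF F0; rewrite -[LHS]/(\int[m]_(z in p @^-1` setT) (F \o p) z).
rewrite -(ge0_integral_pushforward mp)//.
by apply: eq_measure_integral => A mA _; exact: mE.
Qed.

Let measurable_ruellen1 (A : set (Sig S k)) : measurable A ->
  measurable_fun [set: X] (fun x : X => (ruellen phi n (\1_A : Sig S k -> R) x)%:E).
Proof.
move=> mA.
have A01 z : (0 <= (\1_A z : R) <= 1)%R.
  by rewrite indicE; case: (_ \in _); rewrite /= ?lexx ler01.
under eq_fun do rewrite (ruellenE ruelle1 _ A01).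
apply: emeasurable_esum => [V x|V].
  by rewrite lee_fin mulr_ge0 ?branchw_ge0//; case/andP: (A01 (branch S k n V x)).
apply/measurable_EFinP; apply: measurable_funM.
  by apply: measurable_branchw => m; exact: (measurable_potential r01 phi2).
by apply: measurableT_comp; [exact: measurable_indic|exact: measurable_branch].
Qed.

Lemma Wass_le (mu nu : probability X R) :
  Wass r beta phi (ruellen_dual phi mu) (ruellen_dual phi nu) <=
  t%:E * Wass r beta phi mu nu.
Proof.
pose J := (seq nat * seq nat)%type.
pose cc (j : J) (z : X * X) := c j.1 j.2 z.1 z.2.
pose g (j : J) (z : X * X) := (branch S k n j.1 z.1, branch S k n j.2 z.2).
have cc0 j z : (0 <= cc j z)%R by exact: c0.
have mg j : measurable_fun [set: X * X] (g j).
  apply: measurable_fun_pair.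
    exact: (measurableT_comp (@measurable_branch S k n _) measurable_fst).
  exact: (measurableT_comp (@measurable_branch S k n _) measurable_snd).
have esumJ (F : seq nat -> seq nat -> R) : (forall V W, 0 <= F V W)%R ->
    \esum_(j in [set: J]) (F j.1 j.2)%:E =
    \esum_(V in [set: seq nat]) \esum_(W in [set: seq nat]) (F V W)%:E.
  move=> F0; rewrite esum_esum; last by move=> *; rewrite lee_fin.
  by congr esum; apply/seteqP; split.
have cc1 z : \esum_(j in [set: J]) (cc j z)%:E = 1.
  rewrite /cc (esumJ (fun V W => c V W z.1 z.2))//.
  by under eq_esum do rewrite c1; exact: esum_branchw.
(* Dividing by [t > 0] isolates the infimum, so that one coupling [m] of [mu] and [nu] can be
   treated at a time. *)
rewrite -lee_pdivrMl//; apply: le_ereal_inf_tmp => _ [m mcoup <-].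
rewrite lee_pdivrMl//.
(* [M] is the law of [(Vx, Wy)] when [(x, y)] has law [m] and, given [(x, y)], the pair [(V, W)] has
   law [c]. *)
have [M ME] := discrete_kernel_comp cc0 (fun j => mc j.1 j.2) mg cc1 m.
have Mset (B : set (Sig S k * Sig S k)) : measurable B -> M B =
    \int[m]_z \esum_(j in [set: J]) (cc j z)%:E * (\1_B (g j z))%:E.
  move=> mB; rewrite -(ME (fun y => (\1_B y)%:E)).
  - by rewrite integral_indic// setIT.
  - exact/measurable_EFinP/measurable_indic.
  - by move=> y; rewrite lee_fin.
have A01 (A : set (Sig S k)) z : (0 <= (\1_A z : R) <= 1)%R.
  by rewrite indicE; case: (_ \in _); rewrite /= ?lexx ler01.
have A0 (A : set (Sig S k)) z : (0 <= (\1_A z : R))%R by case/andP: (A01 A z).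
have Mcoup : coupling (ruellen_dual phi mu) (ruellen_dual phi nu) M.
  move=> A mA; split.
  - rewrite Mset; last exact: measurableX.
    rewrite /ruellen_dual -(@X_fst m mu fst)//.
    + apply: eq_integral => z _; rewrite (ruellenE ruelle1 _ (A01 A)).
      rewrite -(marginal1 z.1 z.2 (A0 A)) -(esumJ
        (fun V W => c V W z.1 z.2 * \1_A
          (branch S k n V (letter (z.1 : X))))%R); last first.
        by move=> V W; rewrite mulr_ge0.
      apply: eq_esum => j _; rewrite -EFinM; congr (_ * _)%:E.
      by rewrite !indicE in_setX in_setT andbT.
    + move=> B mB; have [<- _] := mcoup B mB.
      by congr (m _); apply/seteqP; split => // -[x y] [].
    + exact: measurable_ruellen1.
    + by move=> x; rewrite lee_fin; case/andP: (ruellen_bound ruelle1 (A01 A) x).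
  - rewrite Mset; last exact: measurableX.
    rewrite /ruellen_dual -(@X_fst m nu snd)//.
    + apply: eq_integral => z _; rewrite (ruellenE ruelle1 _ (A01 A)).
      rewrite -(marginal2 z.1 z.2 (A0 A)) -(esumJ
        (fun V W => c V W z.1 z.2 * \1_A
          (branch S k n W (letter (z.2 : X))))%R); last first.
        by move=> V W; rewrite mulr_ge0.
      apply: eq_esum => j _; rewrite -EFinM; congr (_ * _)%:E.
      by rewrite !indicE in_setX in_setT.
    + move=> B mB; have [_ <-] := mcoup B mB.
      by congr (m _); apply/seteqP; split => // -[x y] [].
    + exact: measurable_ruellen1.
    + by move=> x; rewrite lee_fin; case/andP: (ruellen_bound ruelle1 (A01 A) x).
apply: (@le_trans _ _ (\int[M]_z (dbar z.1 z.2)%:E)).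
  by apply: ereal_inf_lbound; exists M.
have mdbar j : measurable_fun [set: Sig S j * Sig S j]
    (fun z : Sig S j * Sig S j => (dbar z.1 z.2)%:E).
  by apply/measurable_EFinP; exact: measurable_dbar.
rewrite ME//; last by move=> z; rewrite lee_fin dbar_ge0.
rewrite -ge0_integralZl_EFin//; last 2 first.
- by move=> z _; rewrite lee_fin dbar_ge0.
- exact: ltW.
apply: ge0_le_integral => //.
- move=> z _; apply: esum_ge0 => j _.
  by apply: mule_ge0; rewrite lee_fin; [exact: cc0|exact: dbar_ge0].
- apply: emeasurable_esum => [j z|j].
    by apply: mule_ge0; rewrite lee_fin; [exact: cc0|exact: dbar_ge0].
  apply: emeasurable_funM; first by apply/measurable_EFinP; exact: mc.
  exact: (measurableT_comp (mdbar k) (mg j)).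
- by apply: emeasurable_funM.
move=> z _; rewrite -EFinM.
have := cost z.1 z.2; rewrite -(esumJ (fun V W => c V W z.1 z.2 *
  dbar (branch S k n V (letter (z.1:X))) (branch S k n W (letter (z.2:X))))%R)//.
by move=> V W; rewrite mulr_ge0// dbar_ge0.
Qed.

End from_coupling.
End contraction.

(** * Completion of a common part to a coupling, for near and for far pairs *)

Section near_far_coupling.
Variables (R : realType) (S : nsshift) (r beta : R) (phi : forall n, Sig S n -> R).
Arguments phi : clear implicits.
Hypotheses (r01 : 0 < r < 1) (beta01 : 0 < beta < 1).
Hypothesis phi2 : forall n, locally_holder r 2 (phi n).
Hypothesis ruelle1 : forall n x, ruelle (phi n) (fun=> 1) x = 1.

Local Notation dbar := (dbar r beta phi).
Local Notation alpha := (alpha r beta phi).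

Variables (k n : nat) (t : R).
Local Notation X := (Sig S (n + k)).
Variables (E : seq nat -> seq nat -> X -> X -> R) (a b : seq nat -> X -> X -> R).
Variables (c s : R).
Hypotheses (alpha_n : r ^+ n * alpha k <= 1) (beta_t : beta <= t).
Hypotheses (E0 : forall V W x y, 0 <= E V W x y)
  (mE : forall V W, measurable_fun [set: X * X] (fun z : X * X => E V W z.1 z.2))
  (Ea : forall V x y, (\esum_(W in [set: seq nat]) (E V W x y)%:E = (a V x y)%:E)%E)
  (Eb : forall W x y, (\esum_(V in [set: seq nat]) (E V W x y)%:E = (b W x y)%:E)%E)
  (Ec : forall x y, (\esum_(V in [set: seq nat]) (a V x y)%:E = c%:E)%E)
  (ap : forall V x y, a V x y <= branchw phi k n V x)
  (bp : forall W x y, b W x y <= branchw phi k n W y)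
  (s0 : 0 <= s) (cost_t : c * s + (1 - c) <= t)
  (Es : forall V W x y,
    E V W x y * dbar (branch S k n V x) (branch S k n W y) <= E V W x y * s).

Let close (x y : X) : bool := alpha (n + k)%N * dr r x y < 1.
Let theta (x y : X) : R := expR (- (dr r x y * lnB r phi (n + k)%N)).
(** For close pairs the common part is diagonal: [theta] times the weight for [y] lies below the
    weights for both points, by bounded distortion. For the other pairs it is the prescribed [E]. *)
Let e V W (x y : X) : R :=
  if close x y then theta x y * (if V == W then branchw phi k n V y else 0)
  else E V W x y.
Let a' V (x y : X) : R :=
  if close x y then theta x y * branchw phi k n V y else a V x y.
Let b' V (x y : X) : R :=
  if close x y then theta x y * branchw phi k n V y else b V x y.
Let c' (x y : X) : R := if close x y then theta x y else c.

Let cpl V W (x y : X) : R := completed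
  (fun V => branchw phi k n V x) (fun V => branchw phi k n V y) (fun V W => e V W x y)
  (fun V => a' V x y) (fun V => b' V x y) (c' x y) V W.

Let theta_ge0 x y : 0 <= theta x y. Proof. exact: expR_ge0. Qed.

Let theta_le1 x y : theta x y <= 1.
Proof.
rewrite /theta -expR0 ler_expR oppr_le0.
by rewrite mulr_ge0 ?dr_ge0 ?lnB_ge0.
Qed.

Let close_head x y : close x y -> x 0%N = y 0%N.
Proof.
rewrite /close => h; apply: (dr_lt1 r01); apply: le_lt_trans h.
by rewrite ler_peMl ?dr_ge0// ltW// (alpha_gt1 r01 beta01 phi2).
Qed.

Let e0 V W x y : 0 <= e V W x y.
Proof.
by rewrite /e; case: ifP => // _; case: ifP => _; rewrite mulr_ge0// branchw_ge0.
Qed.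

Let ea x y V : (\esum_(W in [set: seq nat]) (e V W x y)%:E = (a' V x y)%:E)%E.
Proof.
rewrite /e /a'; case: ifP => // _.
rewrite (esum_only (t := V)) ?eqxx//.
  by rewrite lee_fin mulr_ge0// branchw_ge0.
by move=> W /eqP WV; rewrite eq_sym (negbTE WV) mulr0.
Qed.

Let eb x y W : (\esum_(V in [set: seq nat]) (e V W x y)%:E = (b' W x y)%:E)%E.
Proof.
rewrite /e /b'; case: ifP => // _.
rewrite (esum_only (t := W)) ?eqxx//.
  by rewrite lee_fin mulr_ge0// branchw_ge0.
by move=> V /eqP WV; rewrite (negbTE WV) mulr0.
Qed.

Let ec x y : (\esum_(V in [set: seq nat]) (a' V x y)%:E = (c' x y)%:E)%E.
Proof.
rewrite /a' /c'; case: ifP => // _.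
under eq_esum do rewrite EFinM.
rewrite esumZl//; last by move=> V; rewrite lee_fin branchw_ge0.
by rewrite esum_branchw// mule1.
Qed.

Let a'p x y V : a' V x y <= branchw phi k n V x.
Proof. by rewrite /a'; case: ifP => // /close_head; exact: branchw_distortion. Qed.

Let b'p x y V : b' V x y <= branchw phi k n V y.
Proof. by rewrite /b'; case: ifP => // _; rewrite ler_piMl// branchw_ge0. Qed.

Let cpl_cost x y : (\esum_(V in [set: seq nat]) \esum_(W in [set: seq nat])
  (cpl V W x y * dbar (branch S k n V x) (branch S k n W y))%:E <= (t * dbar x y)%:E)%E.
Proof.
(* For a close pair, a common word of length [n] contracts [dr] by [r ^+ n], and [dbar] on [Sig S k]
   brings the factor [alpha k]. *)
pose s' := if close x y then r ^+ n * alpha k * dr r x y else s.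
have dr0 := dr_ge0 r01 x y.
have ra0 : 0 <= r ^+ n * alpha k.
  by rewrite mulr_ge0 ?exprn_ge0// ltW//; [case/andP: r01|exact: alpha_gt0].
have s'0 : 0 <= s' by rewrite /s'; case: ifP => // _; rewrite mulr_ge0.
have d01 V W : 0 <= dbar (branch S k n V x) (branch S k n W y) <= 1.
  by rewrite dbar_ge0//= dbar_le1.
have es V W : e V W x y * dbar (branch S k n V x) (branch S k n W y) <= e V W x y * s'.
  rewrite /e /s'; case: ifP => // xy; have [<-{W}|VW] := eqVneq V W; last first.
    by rewrite mulr0 !mul0r.
  have [->|/eqP/branchw_neq0[Vn yk]] := eqVneq (branchw phi k n V y) 0.
    by rewrite mulr0 !mul0r.
  rewrite ler_wpM2l ?mulr_ge0 ?branchw_ge0//.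
  have xk : @admissible S k (prepend V x).
    apply: admissible_prepend_eq yk; first by rewrite Vn.
    - exact: admissible_letter.
    - exact: admissible_letter.
    - exact/esym/close_head.
  rewrite /Defs.dbar ge_min; apply/orP; right.
  rewrite (mulrC (r ^+ n)) -[leRHS]mulrA ler_wpM2l//; first by rewrite ltW// alpha_gt0.
  by apply: (dr_contract r01 Vn); rewrite /branch Vn eqxx letter_sig_of.
apply: le_trans (esum_completed_cost (esum_branchw ruelle1 x) (esum_branchw ruelle1 y)
  (fun V W => e0 V W x y) (ea x y) (eb x y) (ec x y) (a'p x y) (b'p x y) s'0 d01 es) _.
rewrite lee_fin /c' /s'; case: ifP => xy; last first.
  by rewrite /Defs.dbar min_l ?mulr1//; rewrite leNgt; apply/negbT.
rewrite /Defs.dbar min_r; last exact: ltW.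
(* With [d = dr r x y], the matched part costs at most [d] by [alpha_n], and the residual mass is at
   most [d * lnB]. Their sum is at most [d * exp lnB = d * beta * alpha]: dividing by [beta] in
   [alpha] produces the contraction factor [beta <= t]. *)
have h1 : theta x y * (r ^+ n * alpha k * dr r x y) <= dr r x y.
  apply: le_trans (ler_piMl _ (theta_le1 x y)) _; first exact: mulr_ge0.
  exact: ler_piMl.
have h2 : 1 - theta x y <= dr r x y * lnB r phi (n + k)%N.
  have := expR_ge1Dx (- (dr r x y * lnB r phi (n + k)%N)).
  by rewrite -/(theta _ _); lra.
apply: le_trans (lerD h1 h2) _; rewrite -{1}[dr r x y]mulr1 -mulrDr.
apply: (@le_trans _ _ (dr r x y * expR (lnB r phi (n + k)%N))).
  by rewrite ler_wpM2l// expR_ge1Dx.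
have beta0 : 0 < beta by case/andP: beta01.
have alpha0 : 0 <= alpha (n + k)%N by rewrite ltW// alpha_gt0.
have -> : expR (lnB r phi (n + k)%N) = beta * alpha (n + k)%N.
  by rewrite mulrC divfK// gt_eqF.
move: (alpha (n + k)%N) alpha0 => A A0.
by rewrite [leLHS]mulrC -mulrA ler_wpM2r// mulr_ge0.
Qed.

Let measurable_theta : measurable_fun [set: X * X] (fun z : X * X => theta z.1 z.2).
Proof.
apply: measurableT_comp; first exact: measurable_expR.
apply: measurable_funN.
apply: measurable_funM; first exact: measurable_dr.
exact: measurable_cst.
Qed.

Let measurable_if_close (f g : X * X -> R) : measurable_fun [set: X * X] f ->
  measurable_fun [set: X * X] g ->
  measurable_fun [set: X * X] (fun z => if close z.1 z.2 then f z else g z).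
Proof.
move=> mf mg; apply: measurable_fun_ifT => //.
rewrite /close; apply: measurable_fun_ltr; last exact: measurable_cst.
by apply: measurable_funM; [exact: measurable_cst|exact: measurable_dr].
Qed.

Let mphi j : measurable_fun [set: Sig S j] (phi j).
Proof. exact: (measurable_potential r01 phi2). Qed.

Let mpw1 V : measurable_fun [set: X * X]
  (fun z : X * X => branchw phi k n V (letter z.1)).
Proof.
exact: (measurableT_comp (@measurable_branchw _ _ _ k n V mphi) measurable_fst).
Qed.

Let mpw2 V : measurable_fun [set: X * X]
  (fun z : X * X => branchw phi k n V (letter z.2)).
Proof.
exact: (measurableT_comp (@measurable_branchw _ _ _ k n V mphi) measurable_snd).
Qed.

Let ma V : measurable_fun [set: X * X] (fun z : X * X => a V z.1 z.2).
Proof.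
apply/measurable_EFinP; rewrite /comp; under eq_fun do rewrite -Ea.
apply: emeasurable_esum => [W z|W]; first by rewrite lee_fin.
exact/measurable_EFinP.
Qed.

Let mb W : measurable_fun [set: X * X] (fun z : X * X => b W z.1 z.2).
Proof.
apply/measurable_EFinP; rewrite /comp; under eq_fun do rewrite -Eb.
apply: emeasurable_esum => [V z|V]; first by rewrite lee_fin.
exact/measurable_EFinP.
Qed.

Let c'_le1 x y : 0 <= 1 - c' x y.
Proof.
rewrite subr_ge0 -lee_fin -ec -[leRHS](esum_branchw ruelle1 x).
by apply: le_esum => V _; rewrite lee_fin.
Qed.

Let mcpl V W : measurable_fun [set: X * X] (fun z : X * X => cpl V W z.1 z.2).
Proof.
rewrite /cpl /completed; apply: measurable_funD.
  apply: measurable_if_close; last exact: mE.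
  apply: measurable_funM => //; case: (V == W); first exact: mpw2.
  exact: measurable_cst.
apply: measurable_funM.
  apply: measurable_funM; apply: measurable_funB => //.
    by apply: measurable_if_close => //; exact: measurable_funM.
  by apply: measurable_if_close => //; exact: measurable_funM.
(* as a real power, the inverse is known to be measurable *)
under eq_fun do rewrite -powR_inv1//.
apply: (measurableT_comp (measurable_powR (-1))).
apply: measurable_funB; first exact: measurable_cst.
by apply: measurable_if_close => //; exact: measurable_cst.
Qed.

Let t0 : 0 < t. Proof. by apply: lt_le_trans beta_t; case/andP: beta01. Qed.

Let cpl0 V W x y : 0 <= cpl V W x y.
Proof.
exact: (completed_ge0 (esum_branchw ruelle1 x) (fun V W => e0 V W x y) (ea x y) (ec x y)
  (a'p x y) (b'p x y)).
Qed.

Let cpl1 V x y :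
  (\esum_(W in [set: seq nat]) (cpl V W x y)%:E = (branchw phi k n V x)%:E)%E.
Proof.
exact: (esum_completed (esum_branchw ruelle1 x) (esum_branchw ruelle1 y)
  (fun V W => e0 V W x y)
  (ea x y) (eb x y) (ec x y) (a'p x y) (b'p x y)).
Qed.

Let cpl2 W x y :
  (\esum_(V in [set: seq nat]) (cpl V W x y)%:E = (branchw phi k n W y)%:E)%E.
Proof.
under eq_esum do rewrite /cpl completedC.
have ec2 := esum_marginal2 (fun V W => e0 V W x y) (ea x y) (eb x y) (ec x y).
exact: (esum_completed (esum_branchw ruelle1 y) (esum_branchw ruelle1 x)
  (fun V W => e0 W V x y)
  (eb x y) (ea x y) ec2 (b'p x y) (a'p x y)).
Qed.

Lemma Dbar_near_far (f : Sig S k -> R) (M : R) : (forall z, `|f z| <= M) ->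
  (Dbar r beta phi (ruellen phi n f) <= t%:E * Dbar r beta phi f)%E.
Proof.
by move=> fM; exact: (Dbar_le r01 beta01 ruelle1 t0 cpl0 cpl1 cpl2 cpl_cost fM).
Qed.

Lemma Wass_near_far (mu nu : probability X R) :
  (Wass r beta phi (ruellen_dual phi mu) (ruellen_dual phi nu) <=
  t%:E * Wass r beta phi mu nu)%E.
Proof. exact: (Wass_le r01 beta01 phi2 ruelle1 t0 cpl0 cpl1 cpl2 cpl_cost mcpl). Qed.

End near_far_coupling.

(** * Measurable choice of words, and the common part for far pairs *)

Lemma measurable_selection d (X : measurableType d) (W : countType)
    (good : W -> set X) :
  (forall w, measurable (good w)) -> (forall x, exists w, good w x) ->
  exists sel : X -> W, (forall x, good (sel x) x) /\
    forall Q : W -> Prop, measurable [set x | Q (sel x)].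
Proof.
move=> mgood exgood.
pose G i := if pickle_inv i is Some w then good w else set0.
have mG i : measurable (G i) by rewrite /G; case: pickle_inv.
(* Among the good words the one with the least code is selected. *)
have /choice[sel selP] x : exists w, good w x /\
    forall w', good w' x -> (pickle w <= pickle w')%N.
  have ex : exists i, `[< exists w, pickle w = i /\ good w x >].
    by have [w gw] := exgood x; exists (pickle w); apply/asboolP; exists w.
  case: (ex_minnP ex) => i /asboolP[w [<- gw]] min; exists w; split => // w' gw'.
  by apply: min; apply/asboolP; exists w'.
exists sel; split => [x|Q]; first by case: (selP x).
(* The fibre over [w] consists of the points for which [w] is good and no word of smaller code
   is. *)
have mfib w : measurable [set x | sel x = w].
  rewrite [X in measurable X](_ : _ =
      good w `\` \bigcup_(i in `I_(pickle w)) G i).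
    by apply: measurableD => //; apply: bigcup_measurable.
  apply/seteqP; split => [x /= <-|x /= [gw h]].
    have [gx minx] := selP x; split => // -[i /= ix]; rewrite /G.
    case E : pickle_inv => [w'|//] /minx; rewrite leqNgt; apply/negP/negPn.
    by have := @pickle_invK W i; rewrite E /= => ->.
  have [gx minx] := selP x; have := minx _ gw.
  rewrite leq_eqVlt => /orP[/eqP/(pcan_inj pickleK_inv)//|lt]; exfalso.
  by apply: h; exists (pickle (sel x)) => //; rewrite /G pickleK_inv.
rewrite [X in measurable X](_ : _ = \bigcup_i
    (if pickle_inv i is Some w then [set x | Q w /\ sel x = w] else set0)).
  apply: bigcup_measurable => i _; case: pickle_inv => [w|//].
  have [Qw|Qw] := pselect (Q w).
    by rewrite [X in measurable X](_ : _ = [set x | sel x = w])//;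
      apply/seteqP; split => x /=; [case|].
  by rewrite [X in measurable X](_ : _ = set0)//; apply/seteqP; split => x /=; [case|].
apply/seteqP; split => [x /= Qx|x [i _]].
  by exists (pickle (sel x)) => //; rewrite pickleK_inv.
by case: pickle_inv => // w [Qw /= ->].
Qed.

Lemma cat_injl (T : eqType) (w : seq T) : injective (cat ^~ w).
Proof.
move=> v v' /= vw; apply/eqP.
have sv : size v = size v'.
  by apply/eqP; rewrite -(eqn_add2r (size w)) -!size_cat vw.
by move/eqP: vw; rewrite eqseq_cat// => /andP[].
Qed.

Section far_coupling.
Variables (R : realType) (S : nsshift) (r beta : R) (phi : forall n, Sig S n -> R).
Arguments phi : clear implicits.
Hypotheses (r01 : 0 < r < 1) (beta01 : 0 < beta < 1).
Hypothesis phi2 : forall n, locally_holder r 2 (phi n).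
Hypothesis ruelle1 : forall n x, ruelle (phi n) (fun=> 1) x = 1.

Local Notation dbar := (dbar r beta phi).
Local Notation alpha := (alpha r beta phi).

Variables (k n m : nat) (o : nat) (C : R).
Local Notation X := (Sig S ((m + n) + k)).
Hypotheses (C0 : 0 <= C) (m0 : (0 < m)%N).
Hypothesis alpha_n : r ^+ n * alpha k <= 1.

Let good (w : seq nat) (x : nat -> nat) : Prop :=
  [/\ size w = m, head 0%N w = o, @admissible S (n + k) (prepend w x) &
    C <= branchw phi (n + k) m w x].

(* The words [u x] of the theorem need not depend measurably on [x]; all that
   is kept from them is that good words exist, among which a measurable choice
   is possible. *)
Hypothesis exgood : forall x : X, exists w, good w x.

Let mphi j : measurable_fun [set: Sig S j] (phi j).
Proof. exact: (measurable_potential r01 phi2). Qed.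

Let measurable_good w : measurable [set x : X | good w x].
Proof.
have [wm|wm] := pselect (size w = m); last first.
  by rewrite [X in measurable X](_ : _ = set0)//; apply/seteqP; split => x //= [].
have [wo|wo] := pselect (head 0%N w = o); last first.
  by rewrite [X in measurable X](_ : _ = set0)//; apply/seteqP; split => x //= [].
rewrite [X in measurable X](_ : _ =
    [set x : X | @admissible S (n + k) (prepend w x)] `&`
    [set x : X | C <= branchw phi (n + k) m w x]); last first.
  by apply/seteqP; split => x [] //= *; split.
rewrite -addnA; apply: measurableI; first exact: measurable_admissible_prepend.
rewrite -[X in measurable X]setTI.
have := @measurable_branchw R S phi (n + k) m w mphi.
move/(_ measurableT `[C, +oo[%classic (measurable_itv _)).
by congr measurable; congr (_ `&` _); apply/seteqP; split => x /=;
  rewrite in_itv/= andbT.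
Qed.

Let far_sel : exists sel : X -> seq nat, (forall x, good (sel x) x) /\
    forall Q : seq nat -> Prop, measurable [set x | Q (sel x)].
Proof. exact: (measurable_selection measurable_good exgood). Qed.

Section selected.
Variable sel : X -> seq nat.
Hypotheses (selP : forall x, good (sel x) x)
  (msel : forall Q : seq nat -> Prop, measurable [set x | Q (sel x)]).

Let Y (x : X) : Sig S (n + k) := branch S (n + k) m (sel x) x.

Let letterY x : letter (Y x) = prepend (sel x) x.
Proof. by have [sm _ adm _] := selP x; rewrite /Y /branch sm eqxx letter_sig_of. Qed.

Let Y_head x : letter (Y x) 0%N = o.
Proof.
have [sm <- _ _] := selP x; rewrite letterY /prepend sm m0.
exact: nth0.
Qed.

Let theta : R := expR (- lnB r phi (n + k)).

Let theta_ge0 : 0 <= theta. Proof. exact: expR_ge0. Qed.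

Let theta_le1 : theta <= 1.
Proof. by rewrite -expR0 ler_expR oppr_le0 lnB_ge0. Qed.

(** The matched words are [v ++ sel x] and [v ++ sel y], with [v] recovered as [take n V]. The
    factor [C] bounds the weights of the selected words from below; [theta] absorbs the distortion
    between [Y x] and [Y y], which share the first letter [o] and are at distance at most 1. *)
Let e (V W : seq nat) (x y : X) : R :=
  if (V == take n V ++ sel x) && (W == take n V ++ sel y)
  then C * theta * branchw phi k n (take n V) (Y y) else 0.
Let a (V : seq nat) (x y : X) : R :=
  if V == take n V ++ sel x then C * theta * branchw phi k n (take n V) (Y y) else 0.
Let b (W : seq nat) (x y : X) : R :=
  if W == take n W ++ sel y then C * theta * branchw phi k n (take n W) (Y y) else 0.

Let weight_ge0 V y : 0 <= C * theta * branchw phi k n V (Y y).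
Proof. by rewrite !mulr_ge0 ?branchw_ge0. Qed.

Let e0 V W x y : 0 <= e V W x y.
Proof. by rewrite /e; case: ifP. Qed.

Let ea V x y : (\esum_(W in [set: seq nat]) (e V W x y)%:E = (a V x y)%:E)%E.
Proof.
rewrite /e /a; case: eqP => _ /=; last by rewrite esum1.
rewrite (esum_only (t := take n V ++ sel y)) ?eqxx ?lee_fin//.
by move=> W /eqP/negbTE ->.
Qed.

(** [e] reads the common word off [V]. A nonzero weight forces this word to have length [n], so that
    it is also read off [W]. *)
Let eb W x y : (\esum_(V in [set: seq nat]) (e V W x y)%:E = (b W x y)%:E)%E.
Proof.
rewrite /e /b; have [pW0|/eqP/branchw_neq0[Wn _]] :=
    eqVneq (branchw phi k n (take n W) (Y y)) 0.
  rewrite pW0 mulr0 if_same esum1// => V _.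
  case: ifP => // /andP[_ /eqP WE].
  have [->|/eqP/branchw_neq0[Vn _]] := eqVneq (branchw phi k n (take n V) (Y y)) 0.
    by rewrite mulr0.
  by move: pW0; rewrite WE take_size_cat// => ->; rewrite mulr0.
rewrite (esum_only (t := take n W ++ sel x)) ?take_size_cat ?eqxx//=.
  by rewrite lee_fin; case: ifP.
move=> V VW; case: ifP => // /andP[/eqP VE /eqP WE].
have [->|/eqP/branchw_neq0[Vn _]] := eqVneq (branchw phi k n (take n V) (Y y)) 0.
  by rewrite mulr0.
by exfalso; apply: VW; rewrite VE WE take_size_cat.
Qed.

Let ec x y : (\esum_(V in [set: seq nat]) (a V x y)%:E = (C * theta)%:E)%E.
Proof.
rewrite (esum_inj (g := fun v => v ++ sel x)); last 2 first.
- exact: cat_injl.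
- move=> V h; rewrite /a; case: eqP => // VE; exfalso; apply: h.
  by exists (take n V).
rewrite -[RHS]mule1 -(esum_branchw ruelle1 (Y y)) -esumZl ?mulr_ge0//; last first.
  by move=> V; rewrite lee_fin branchw_ge0.
apply: eq_esum => v _; rewrite -EFinM /a; case: eqP => [/cat_injl <-//|].
have [->|/eqP/branchw_neq0[vn _]] := eqVneq (branchw phi k n v (Y y)) 0.
  by rewrite mulr0.
by rewrite take_size_cat.
Qed.

Let theta_branchw v x y : theta * branchw phi k n v (Y y) <= branchw phi k n v (Y x).
Proof.
have h : letter (Y x) 0%N = letter (Y y) 0%N by rewrite !Y_head.
apply: le_trans (branchw_distortion r01 phi2 v h).
rewrite ler_wpM2r ?branchw_ge0// ler_expR lerN2 ler_piMl ?lnB_ge0//.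
exact: dr_le1.
Qed.

Let branchw_sel v x : size v = n ->
  C * branchw phi k n v (Y x) <= branchw phi k (m + n) (v ++ sel x) x.
Proof.
move=> vn; have [sm _ _ Cx] := selP x.
by rewrite branchw_cat// letterY ler_wpM2r// branchw_ge0.
Qed.

Let ap V x y : a V x y <= branchw phi k (m + n) V x.
Proof.
rewrite /a; case: eqP => [VE|_]; last exact: branchw_ge0.
have [->|/eqP/branchw_neq0[vn _]] := eqVneq (branchw phi k n (take n V) (Y y)) 0.
  by rewrite mulr0 branchw_ge0.
rewrite [in leRHS]VE; apply: le_trans (branchw_sel x vn).
by rewrite -mulrA ler_wpM2l.
Qed.

Let bp W x y : b W x y <= branchw phi k (m + n) W y.
Proof.
rewrite /b; case: eqP => [WE|_]; last exact: branchw_ge0.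
have [->|/eqP/branchw_neq0[vn _]] := eqVneq (branchw phi k n (take n W) (Y y)) 0.
  by rewrite mulr0 branchw_ge0.
rewrite [in leRHS]WE; apply: le_trans (branchw_sel y vn).
by rewrite -mulrA ler_wpM2l// ler_piMl// branchw_ge0.
Qed.

(** [Y x] and [Y y] are at distance at most 1, and the common word of length [n] contracts by
    [r ^+ n]. *)
Let es V W x y : e V W x y * dbar (branch S k (m + n) V x) (branch S k (m + n) W y)
  <= e V W x y * (r ^+ n * alpha k).
Proof.
rewrite /e; case: ifP => [/andP[/eqP VE /eqP WE]|]; last by rewrite !mul0r.
have [->|/eqP/branchw_neq0[vn yk]] :=
    eqVneq (branchw phi k n (take n V) (Y y)) 0.
  by rewrite mulr0 !mul0r.
rewrite ler_wpM2l// /Defs.dbar ge_min; apply/orP; right.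
rewrite mulrC ler_wpM2r//; first by rewrite ltW// alpha_gt0.
set v := take n V in VE WE vn yk.
have xk : @admissible S k (prepend v (Y x)).
  apply: admissible_prepend_eq yk; first by rewrite vn.
  - exact: admissible_letter.
  - exact: admissible_letter.
  - by rewrite !Y_head.
have extE z U : U = v ++ sel z -> @admissible S k (prepend v (Y z)) ->
    letter (branch S k (m + n) U z) = prepend v (Y z).
  move=> -> adm; rewrite /branch size_cat vn; have [-> _ _ _] := selP z.
  by rewrite addnC eqxx prepend_cat -letterY letter_sig_of.
have := dr_contract r01 vn (extE x V VE xk) (extE y W WE yk).
by move/le_trans; apply; rewrite ler_piMr ?dr_le1// exprn_ge0// ltW//; case/andP: r01.
Qed.

Let mpw V w : measurable_fun [set: X]
  (fun y : X => branchw phi k n V (letter (branch S (n + k) m w y))).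
Proof.
rewrite -addnA.
exact: (measurableT_comp (@measurable_branchw _ _ _ k n V mphi)
  (@measurable_branch S (n + k) m w)).
Qed.

Let me V W : measurable_fun [set: X * X] (fun z : X * X => e V W z.1 z.2).
Proof.
(* Where the condition holds, [sel z.2] is the part of [W] after [take n V], a fixed word; this
   removes the selection from the point at which the weight is taken. *)
rewrite [X in measurable_fun _ X](_ : _ = (fun z : X * X =>
    if (V == take n V ++ sel z.1) && (W == take n V ++ sel z.2)
    then C * theta * branchw phi k n (take n V)
      (letter (branch S (n + k) m (drop (size (take n V)) W) (letter (z.2 : X))))
    else 0)); last first.
  apply/funext => z; rewrite /e /Y; case: ifP => // /andP[_ /eqP WE].
  by rewrite [in RHS]WE drop_size_cat.
apply: measurable_fun_ifT.
- have mQ (p : X * X -> X) (Q : pred (seq nat)) : measurable_fun [set: X * X] p ->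
      measurable_fun [set: X * X] (fun z => Q (sel (p z))).
    move=> mp; apply: (measurable_fun_bool true).
    exact: (mp measurableT _ (msel Q)).
  apply: measurable_and.
    exact: (mQ fst (fun w => V == take n V ++ w) measurable_fst).
  exact: (mQ snd (fun w => W == take n V ++ w) measurable_snd).
- apply: measurable_funM; first exact: measurable_cst.
  exact: (measurableT_comp (mpw _ _) measurable_snd).
- exact: measurable_cst.
Qed.

Variable t : R.
Hypotheses (beta_le_t : beta <= t)
  (t_ge : 1 - (1 - r ^+ n * alpha k) * C / Bcst r phi (n + k) <= t).

Let s0 : 0 <= r ^+ n * alpha k.
Proof.
by rewrite mulr_ge0 ?exprn_ge0// ltW//; [case/andP: r01|exact: alpha_gt0].
Qed.

Let alpha_mn : r ^+ (m + n) * alpha k <= 1.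
Proof.
rewrite exprD -mulrA mulr_ile1// ?exprn_ge0 ?exprn_ile1//;
  by case/andP: r01 => *; exact: ltW.
Qed.

(** Since [theta] is the inverse of [Bcst], the left side equals the second term of the maximum that
    defines [t_k]. *)
Let cost_t : C * theta * (r ^+ n * alpha k) + (1 - C * theta) <= t.
Proof.
apply: le_trans t_ge; rewrite BcstE -expRN -/theta le_eqVlt; apply/orP; left.
by apply/eqP; ring.
Qed.

Lemma Dbar_far_sel (f : Sig S k -> R) (M : R) : (forall z, `|f z| <= M) ->
  (Dbar r beta phi (ruellen phi (m + n) f) <= t%:E * Dbar r beta phi f)%E.
Proof.
exact: (Dbar_near_far r01 beta01 phi2 ruelle1 alpha_mn beta_le_t e0 ea eb ec
  ap bp s0 cost_t es).
Qed.

Lemma Wass_far_sel (mu nu : probability X R) :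
  (Wass r beta phi (ruellen_dual phi mu) (ruellen_dual phi nu) <=
  t%:E * Wass r beta phi mu nu)%E.
Proof.
exact: (Wass_near_far r01 beta01 phi2 ruelle1 alpha_mn beta_le_t e0 me ea eb ec
  ap bp s0 cost_t es).
Qed.

End selected.

Variable t : R.
Hypotheses (beta_le_t : beta <= t)
  (t_ge : 1 - (1 - r ^+ n * alpha k) * C / Bcst r phi (n + k) <= t).

Lemma Dbar_far (f : Sig S k -> R) (M : R) : (forall z, `|f z| <= M) ->
  (Dbar r beta phi (ruellen phi (m + n) f) <= t%:E * Dbar r beta phi f)%E.
Proof.
have [sel [selP msel]] := far_sel.
exact: (Dbar_far_sel selP beta_le_t t_ge).
Qed.

Lemma Wass_far (mu nu : probability X R) :
  (Wass r beta phi (ruellen_dual phi mu) (ruellen_dual phi nu) <=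
  t%:E * Wass r beta phi mu nu)%E.
Proof.
have [sel [selP msel]] := far_sel.
exact: (Wass_far_sel selP msel beta_le_t t_ge).
Qed.

End far_coupling.

(** * The constants of the theorem and the conclusion *)

Lemma holder_bounded (R : realType) (S : nsshift) r k (f : Sig S k -> R) :
  holder r f -> exists M, forall z, `|f z| <= M.
Proof.
move=> [_]; case E : (ereal_sup _) => [M| |]// _.
- exists M => z; rewrite -lee_fin -E; apply: ereal_sup_ubound.
  by exists z.
- have : (`|f point|%:E <= -oo)%E by rewrite -E; apply: ereal_sup_ubound; exists point.
  by [].
Qed.

Lemma locally_holder_le (R : realType) (S : nsshift) r (m m' : nat) k
    (f : Sig S k -> R) : (m <= m')%N ->
  locally_holder r m f -> locally_holder r m' f.
Proof.
move=> mm' [kappa [k0 h]]; exists kappa; split => // j m'j.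
by apply: h; exact: leq_trans m'j.
Qed.

(** As [ln r < 0], the inequality [- ln a / ln r < n] becomes [n * ln r + ln a < 0]. *)
Lemma exp_floor_mul_le1 (R : realType) (r a : R) (n : nat) :
  0 < r < 1 -> 0 < a -> Num.floor (- ln a / ln r) + 1 <= n%:Z ->
  r ^+ n * a <= 1.
Proof.
move=> /andP[r0 r1] a0 nge.
have lr : ln r < 0 by rewrite ln_lt0// r0.
have h : - ln a / ln r < n%:R.
  apply: lt_le_trans (floorD1_gt _) _.
  by rewrite -[n%:R]/((n%:Z)%:~R) ler_int.
rewrite ltr_ndivrMr// in h.
rewrite -[r]lnK ?posrE// -[X in _ * X]lnK ?posrE// -expRM_natl -expRD.
by rewrite -[leRHS]expR0 ler_expR -lerBrDr sub0r ltW.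
Qed.

Section inverse_branch_constant.
Variables (R : realType) (S : nsshift) (phi : forall n, Sig S n -> R).
Arguments phi : clear implicits.
Variables (k m : nat) (u : Sig S (m + k) -> seq nat).
Variable (hu : forall x, (@Titer S k m @` cyl (u x)) x).

Lemma Ccst_ge0 : 0 <= Ccst phi hu.
Proof.
apply: lb_le_inf => [|_ [x _ <-]]; last exact: expR_ge0.
by exists (expR (birkhoff phi m (tau (hu point)))), point.
Qed.

(** The preimage chosen by [tau] is determined: the cylinder fixes its first [m] letters, and its
    image under [Titer] the others. *)
Lemma letter_tau x : size (u x) = m ->
  letter (tau (hu x)) = prepend (u x) x.
Proof.
move=> um; rewrite /tau; case: cid2 => y /= cy yx.
apply/funext => i; rewrite /prepend um; case: ltnP => im.
  by apply: cy; rewrite um.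
by rewrite -yx letter_Titer /seq_shift subnK.
Qed.

Lemma Ccst_le_branchw x : size (u x) = m -> Ccst phi hu <= branchw phi k m (u x) x.
Proof.
move=> um; have uE := letter_tau um.
rewrite /branchw um eqxx asboolT/=; last by rewrite -uE; exact: admissible_letter.
apply: ge_inf; last by exists x => //; rewrite birkhoffE uE.
by exists 0 => _ [y _ <-]; exact: expR_ge0.
Qed.

End inverse_branch_constant.

Theorem lemma2p1 (R : realType) (S : nsshift) (I K : set nat)
  (r beta : R) (phi : forall k, Sig S k -> R)
  (r01 : 0 < r < 1) (beta01 : 0 < beta < 1)
  (Hstar : property_Hstar r phi I K)
  (n_ : nat -> nat)
  (n_pos : forall k, (0 < n_ k)%N)
  (n_ge : forall k,
    Num.floor (- ln (alpha r beta phi k) / ln r) + 1 <= (n_ k)%:Z)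
  (o_ : nat -> nat) (o_W1 : forall k, W1 S k (o_ k))
  (m_ : nat -> nat)
  (m_least : forall k, least_reaching R S I K k (o_ k) (m_ k))
  (U : nat -> set (seq nat))
  (U_fin : forall k, finite_set (U k))
  (U_words : forall k, U k `<=` words S k (m_ k))
  (U_reach : forall k j, I j -> W1 S ((m_ k).-1 + k) j ->
    exists w, [/\ U k w, head 0%N w = o_ k & last 0%N w = j])
  (u : forall k, Sig S (m_ k + k) -> seq nat)
  (u_U : forall k x, U k (u k x))
  (u_head : forall k x, head 0%N (u k x) = o_ k)
  (u_last : forall k x, I (last 0%N (u k x)))
  (u_pre : forall k x, (@Titer S k (m_ k) @` cyl (u k x)) x)
  (f : forall k, Sig S k -> R) (f_holder : forall k, holder r (f k))
  (mu nu : forall k, probability (Sig S k) R) :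
  let t_ (k : nat) : R :=
    Num.max beta (1 - (1 - r ^+ n_ k * alpha r beta phi k)
      * Ccst phi (u_pre (n_ k + k)%N) / Bcst r phi (n_ k + k)) in
  let l_ (k : nat) : nat := (m_ (n_ k + k) + n_ k)%N in
  forall k : nat,
  [/\ (Dbar r beta phi (ruellen phi (n_ k) (f k)) <= Dbar r beta phi (f k))%E,
      (Dbar r beta phi (ruellen phi (l_ k) (f k))
        <= (t_ k)%:E * Dbar r beta phi (f k))%E,
      (Wass r beta phi (ruellen_dual phi (mu (n_ k + k)%N))
                       (ruellen_dual phi (nu (n_ k + k)%N))
        <= Wass r beta phi (mu (n_ k + k)%N) (nu (n_ k + k)%N))%E &
      (Wass r beta phi (ruellen_dual phi (mu (l_ k + k)%N))
                       (ruellen_dual phi (nu (l_ k + k)%N))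
        <= (t_ k)%:E * Wass r beta phi (mu (l_ k + k)%N) (nu (l_ k + k)%N))%E].
Proof.
move=> t_ l_ k.
have [[_ _ _ _ _] ruelle1 phiK' phiK] := Hstar.
have phi2 n : locally_holder r 2 (phi n).
  have [Kn|Kn] := pselect (K n); last exact: phiK'.
  exact: (locally_holder_le _ (phiK n Kn)).
have alpha_n : r ^+ n_ k * alpha r beta phi k <= 1.
  by apply: exp_floor_mul_le1 => //; exact: alpha_gt0.
have beta1 : beta <= 1 by case/andP: beta01 => _ /ltW.
have [M fM] := holder_bounded (f_holder k).
(* The common part over [n_ k] steps is empty for far pairs. *)
pose z (V W : seq nat) (x y : Sig S (n_ k + k)) : R := 0.
pose z1 (V : seq nat) (x y : Sig S (n_ k + k)) : R := 0.
have z0 V W x y : 0 <= z V W x y by rewrite /z.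
have mz V W : measurable_fun [set: Sig S (n_ k + k) * Sig S (n_ k + k)]
    (fun w : Sig S (n_ k + k) * Sig S (n_ k + k) => z V W w.1 w.2).
  exact: measurable_cst.
have za V x y : (\esum_(W in [set: seq nat]) (z V W x y)%:E = (z1 V x y)%:E)%E.
  by rewrite esum1.
have zb W x y : (\esum_(V in [set: seq nat]) (z V W x y)%:E = (z1 W x y)%:E)%E.
  by rewrite esum1.
have zc x y : (\esum_(V in [set: seq nat]) (z1 V x y)%:E = 0%:E)%E.
  by rewrite esum1.
have zp V x y : z1 V x y <= branchw phi k (n_ k) V x by exact: branchw_ge0.
have zq V x y : z1 V x y <= branchw phi k (n_ k) V y by exact: branchw_ge0.
have zt : 0 * 0 + (1 - 0) <= 1 :> R by rewrite mul0r add0r subr0.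
have zs V W x y : z V W x y * dbar r beta phi (branch S k (n_ k) V x)
    (branch S k (n_ k) W y) <= z V W x y * 0 by rewrite /z !mul0r.
set k' := (n_ k + k)%N.
have [m0 _ _] := (m_least k').1.
pose C := Ccst phi (u_pre k').
have good (x : Sig S (m_ k' + n_ k + k)) : exists w : seq nat,
    [/\ size w = m_ k', head 0%N w = o_ k', @admissible S (n_ k + k) (prepend w x) &
      C <= branchw phi (n_ k + k) (m_ k') w x].
  (* The same sequence as [x], moved to the type indexed by [m_ k' + (n_ k + k)] on which [u] is
     defined. *)
  pose x' := sig_of S (m_ k' + k') x.
  have x'E : letter x' = x.
    by rewrite letter_sig_of// /k' addnA; exact: admissible_letter.
  have um : size (u k' x') = m_ k' by have [] := U_words _ _ (u_U k' x').
  exists (u k' x'); split => //; rewrite -x'E.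
  - by rewrite -(letter_tau (u_pre k') um); exact: admissible_letter.
  - exact: Ccst_le_branchw.
have C0 : 0 <= C by exact: Ccst_ge0.
have bt : beta <= t_ k by rewrite le_max lexx.
have tt : 1 - (1 - r ^+ n_ k * alpha r beta phi k) * C / Bcst r phi (n_ k + k)
    <= t_ k by rewrite le_max lexx orbT.
split.
(* The estimates over [n_ k] steps are the case [t = 1]: with an empty common part a far pair costs
   at most 1, which is its [dbar]. *)
- rewrite -[leRHS]mul1e.
  exact: (Dbar_near_far r01 beta01 phi2 ruelle1 alpha_n beta1 z0 za zb zc zp zq
    (lexx 0) zt zs fM).
- exact: (Dbar_far r01 beta01 phi2 ruelle1 C0 m0 alpha_n good bt tt fM).
- rewrite -[leRHS]mul1e.
  exact: (Wass_near_far r01 beta01 phi2 ruelle1 alpha_n beta1 z0 mz za zb zc zp zq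
    (lexx 0) zt zs).
- exact: (Wass_far r01 beta01 phi2 ruelle1 C0 m0 alpha_n good bt tt).
Qed.
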